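(* For every $(\widetilde{N},\widetilde{M},\widetilde{L})\in\widetilde{U}_3$, $$A_{\widetilde{N},\widetilde{M}}\cdot A_{\widetilde{M},\widetilde{L}}=G\big(2[\widetilde{M},-tr(\widetilde{\omega}_{\widetilde{L}})]\big)\cdot A_{\widetilde{N},\widetilde{L}}.$$
   Context: Let $K$ be an unramified extension of $\mathbb{Q}_2$ of degree $d$, $\mathcal{O}_K$ its ring of integers, $\mathfrak{m}_K=2\mathcal{O}_K$, $R=\mathcal{O}_K/\mathfrak{m}_K^2$, $tr:R\to\mathbb{Z}/4$ the trace. Let $(\widetilde{V},\widetilde{\omega})$ be a free symplectic $R$-module of rank $2n$. An oriented Lagrangian is a pair $(\widetilde{L},o_{\widetilde{L}})$, where $\widetilde{L}\subset\widetilde{V}$ is a free Lagrangian submodule and $o_{\widetilde{L}}$ is a generator of $\wedge^n\widetilde{L}$ over $R$; it is denoted simply $\widetilde{L}$, and $OLag(\widetilde{V})$ is the set of these. A pair $(\widetilde{M},\widetilde{L})$ is in general position if $\widetilde{M}+\widetilde{L}=\widetilde{V}$; $\widetilde{U}_3\subset OLag(\widetilde{V})^3$ is the set of triples pairwise in general position. For $(\widetilde{N},\widetilde{M},\widetilde{L})\in\widetilde{U}_3$, $r^{\widetilde{L}}:\widetilde{M}\to\widetilde{N}$ is the linear map with $r^{\widetilde{L}}(\widetilde{m})-\widetilde{m}\in\widetilde{L}$ for all $\widetilde{m}\in\widetilde{M}$, and $\widetilde{\omega}_{\widetilde{L}}:\widetilde{M}\times\widetilde{M}\to R$ is the (non-degenerate)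 symmetric form $\widetilde{\omega}_{\widetilde{L}}(\widetilde{m}_1,\widetilde{m}_2)=\widetilde{\omega}(r^{\widetilde{L}}(\widetilde{m}_1),\widetilde{m}_2)$. For a free $\mathbb{Z}/4\mathbb{Z}$-module $W$ of finite rank with a non-degenerate symmetric bilinear form $B$, $[W,B]$ denotes its isomorphism class, $m[W,B]$ the $m$-fold orthogonal direct sum, and $G([W,B])=\sum_{v\in W/2W}e^{\frac{2\pi i}{4}B(v,v)}$; $G$ is multiplicative for orthogonal direct sums. For an $R$-valued form $B$, $tr(B)$ is the $\mathbb{Z}/4\mathbb{Z}$-valued form $tr\circ B$ on the underlying $\mathbb{Z}/4\mathbb{Z}$-module. For $(\widetilde{M},\widetilde{L})$ in general position, $A_{\widetilde{M},\widetilde{L}}=G(2[R^n,tr(B_{\widetilde{M},\widetilde{L}})])$, where $B_{\widetilde{M},\widetilde{L}}(x,y)=x_1y_1+\dots+x_{n-1}y_{n-1}+\widetilde{\omega}_\wedge(o_{\widetilde{L}},o_{\widetilde{M}})\,x_ny_n$ on $R^n$ and $\widetilde{\omega}_\wedge:\wedge^n\widetilde{L}\times\wedge^n\widetilde{M}\to R$ is the pairing induced from $\widetilde{\omega}$ ($\widetilde{\omega}_\wedge(l_1\wedge\dots\wedge l_n,m_1\wedge\dots\wedge m_n)=\det(\widetilde{\omega}(l_i,m_j))$). *)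

(* Defs.v *)
From HB Require Import structures.
From mathcomp Require Import all_boot all_order all_algebra all_field.
From mathcomp Require Import boolp classical_sets fsbigop reals trigo.
From mathcomp Require Import complex freeg.
Set Implicit Arguments.
Unset Strict Implicit.
Unset Printing Implicit Defensive.
Import GRing.Theory.
Local Open Scope ring_scope.

(* MathComp, with the classical and real layers of MathComp-Analysis. *)

(* Z_2 is the inverse limit of the rings Z/2^(k+1). *)
Definition coherent (x : forall k, 'Z_(2 ^ k.+1)) : Prop :=
  forall k, (x k.+1 : nat)%:R = x k.

Record Z2 := MkZ2 { z2seq :> forall k, 'Z_(2 ^ k.+1); z2P : coherent z2seq }.

Section Z2Ring.
Implicit Types x y z : Z2.

Lemma z2_inj x y : (forall k, x k = y k) -> x = y.
Proof.
case: x y => [x px] [y py] /= exy.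
have exy' : x = y by apply: functional_extensionality_dep.
by case: _ / exy' py => py; congr MkZ2; apply: Prop_irrelevance.
Qed.

Lemma exp2S_gt1 k : (1 < 2 ^ k.+1)%N.
Proof. by rewrite -[X in (X < _)%N](expn0 2) ltn_exp2l. Qed.

Lemma natr_mod2X k a : (a %% 2 ^ k.+2)%:R = a%:R :> 'Z_(2 ^ k.+1).
Proof.
rewrite {2}(divn_eq a (2 ^ k.+2)) natrD natrM (expnS 2 k.+1) (natrM _ 2) pchar_Zp ?exp2S_gt1 //.
by rewrite !mulr0 add0r.
Qed.

Lemma val_natr2X k a : (a%:R : 'Z_(2 ^ k.+1)) = (a %% 2 ^ k.+1)%N :> nat.
Proof. by rewrite val_Zp_nat // exp2S_gt1. Qed.

Lemma natr_cast k (a : nat) :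
  (((a%:R : 'Z_(2 ^ k.+2)) : nat)%:R = a%:R :> 'Z_(2 ^ k.+1)).
Proof. by rewrite val_natr2X natr_mod2X. Qed.

Lemma coherent_nat (a : nat) : coherent (fun k => a%:R).
Proof. by move=> k; rewrite natr_cast. Qed.

Lemma coherentD x y : coherent (fun k => x k + y k).
Proof.
move=> k; rewrite -(z2P x k) -(z2P y k) -natrD.
by rewrite -{1}(natr_Zp (x k.+1)) -{1}(natr_Zp (y k.+1)) -natrD natr_cast.
Qed.

Lemma coherentM x y : coherent (fun k => x k * y k).
Proof.
move=> k; rewrite -(z2P x k) -(z2P y k) -natrM.
by rewrite -{1}(natr_Zp (x k.+1)) -{1}(natr_Zp (y k.+1)) -natrM natr_cast.
Qed.

Lemma coherentN x : coherent (fun k => - x k).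
Proof.
move=> k; apply/eqP; rewrite -(z2P x k) -addr_eq0 -natrD; apply/eqP.
rewrite -(natr_cast k) natrD.
by rewrite !natr_Zp addNr.
Qed.

HB.instance Definition _ := gen_eqMixin Z2.
HB.instance Definition _ := gen_choiceMixin Z2.

Definition z2_zero := MkZ2 (coherent_nat 0).
Definition z2_one := MkZ2 (coherent_nat 1).
Definition z2_add x y := MkZ2 (coherentD x y).
Definition z2_mul x y := MkZ2 (coherentM x y).
Definition z2_opp x := MkZ2 (coherentN x).

Lemma z2_addA : associative z2_add.
Proof. by move=> x y z; apply: z2_inj => k /=; rewrite addrA. Qed.
Lemma z2_addC : commutative z2_add.
Proof. by move=> x y; apply: z2_inj => k /=; rewrite addrC. Qed.
Lemma z2_add0 : left_id z2_zero z2_add.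
Proof. by move=> x; apply: z2_inj => k /=; rewrite add0r. Qed.
Lemma z2_addN : left_inverse z2_zero z2_opp z2_add.
Proof. by move=> x; apply: z2_inj => k /=; rewrite addNr. Qed.
HB.instance Definition _ :=
  GRing.isZmodule.Build Z2 z2_addA z2_addC z2_add0 z2_addN.

Lemma z2_mulA : associative z2_mul.
Proof. by move=> x y z; apply: z2_inj => k /=; rewrite mulrA. Qed.
Lemma z2_mulC : commutative z2_mul.
Proof. by move=> x y; apply: z2_inj => k /=; rewrite mulrC. Qed.
Lemma z2_mul1 : left_id z2_one z2_mul.
Proof. by move=> x; apply: z2_inj => k /=; rewrite mul1r. Qed.
Lemma z2_mulD : left_distributive z2_mul +%R.
Proof. by move=> x y z; apply: z2_inj => k /=; rewrite mulrDl. Qed.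
Lemma z2_1n0 : z2_one != 0.
Proof.
apply/eqP => /(congr1 (fun x : Z2 => x 0)) /= /eqP.
by rewrite (oner_eq0 'Z_(2 ^ 1)).
Qed.
HB.instance Definition _ :=
  GRing.Zmodule_isComNzRing.Build Z2 z2_mulA z2_mulC z2_mul1 z2_mulD z2_1n0.

Definition z2_unit : pred Z2 := fun x => `[< exists y, y * x = 1 >].
Definition z2_inv x : Z2 := if pselect (exists y, y * x = 1) is left h
  then projT1 (cid h) else x.

Lemma z2_mulV : {in z2_unit, left_inverse 1 z2_inv *%R}.
Proof.
move=> x /asboolP ux; rewrite /z2_inv; case: pselect => // h.
by case: (cid h).
Qed.
Lemma z2_unitP x y : y * x = 1 -> z2_unit x.
Proof. by move=> e; apply/asboolP; exists y. Qed.
Lemma z2_invN : {in [predC z2_unit], z2_inv =1 id}.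
Proof.
by move=> x /asboolP nux; rewrite /z2_inv; case: pselect.
Qed.
HB.instance Definition _ :=
  GRing.ComNzRing_hasMulInverse.Build Z2 z2_mulV z2_unitP z2_invN.

Lemma z2_zero_leq x i k : (i <= k)%N -> x k = 0 -> x i = 0.
Proof.
move=> /subnK <-; elim: (k - i)%N => // m IH.
by rewrite addSn => e; apply: IH; rewrite -(z2P x) e.
Qed.

Lemma z2_cong x i k : (i <= k)%N -> x i = (x k : nat)%:R.
Proof.
move=> /subnK <-; elim: (k - i)%N => [|m IH]; first by rewrite natr_Zp.
rewrite addSn IH -(z2P x (m + i)) val_natr2X.
rewrite {2}(divn_eq (x (m + i).+1) (2 ^ (m + i).+1)) natrD natrM.
rewrite -addnS expnD [(2 ^ m * _)%:R]natrM pchar_Zp ?exp2S_gt1 //.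
by rewrite !mulr0 add0r.
Qed.

Lemma natr2X_eq0 k a : ((a%:R : 'Z_(2 ^ k.+1)) == 0) = (2 ^ k.+1 %| a)%N.
Proof. by rewrite -val_eqE /= val_natr2X. Qed.

Lemma z2_domain x y : x * y = 0 -> (x == 0) || (y == 0).
Proof.
move=> xy0; apply/orP; apply: contrapT => /not_orP [/negP/eqP x0 /negP/eqP y0].
have nz z : z <> 0 -> exists i, z i != 0.
  move=> nz; apply: contrapT => /forallNP h; apply: nz; apply: z2_inj => k.
  by apply/eqP; apply: contrapT => /negP /h.
have [i xi] := nz x x0; have [j yj] := nz y y0.
have e : x (i + j)%N * y (i + j)%N = 0.
  by have := congr1 (fun z : Z2 => z (i + j)%N) xy0.
move: xi yj e; rewrite (z2_cong x (leq_addr j i)) (z2_cong y (leq_addl i j)).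
set a := x (i + j)%N; set b := y (i + j)%N.
rewrite !natr2X_eq0 -{2}(natr_Zp a) -{2}(natr_Zp b) -natrM => xi yj /eqP.
have a0 : (0 < a)%N by case: posnP xi => // ->; rewrite dvdn0.
have b0 : (0 < b)%N by case: posnP yj => // ->; rewrite dvdn0.
rewrite natr2X_eq0 pfactor_dvdn ?muln_gt0 ?a0 // lognM //.
move: xi yj; rewrite !pfactor_dvdn // -!leqNgt => xi yj.
by rewrite leqNgt ltnS leq_add.
Qed.
HB.instance Definition _ :=
  GRing.ComUnitRing_isIntegral.Build Z2 z2_domain.
End Z2Ring.

Definition Q2 := {fraction Z2}.

Definition Z2_to (K : fieldExtType Q2) : Z2 -> K := in_alg K \o @tofrac Z2.
HB.instance Definition _ K := GRing.RMorphism.on (@Z2_to K).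

Lemma Z2_to_inj (K : fieldExtType Q2) : injective (@Z2_to K).
Proof.
by move=> x y /(fmorph_inj (in_alg K)) /eqP; rewrite tofrac_eq => /eqP.
Qed.

(* O_K is the integral closure of Z_2 in K. *)
Definition integral_closure (K : fieldExtType Q2) : {pred K} :=
  fun x => `[< integralOver (@Z2_to K) x >].

Section RingOfIntegers.
Variable K : fieldExtType Q2.

Lemma integral_closure_subring : subring_closed (@integral_closure K).
Proof.
split; first by apply/asboolP; apply: integral1.
- move=> x y /asboolP ix /asboolP iy; apply/asboolP; exact: integral_sub.
- move=> x y /asboolP ix /asboolP iy; apply/asboolP; exact: integral_mul.
Qed.
HB.instance Definition _ :=
  GRing.isSubringClosed.Build K (@integral_closure K) integral_closure_subring.

Record OK := MkOK { OKval : K; OKP : OKval \in @integral_closure K }.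
HB.instance Definition _ := [isSub for OKval].
HB.instance Definition _ := [Choice of OK by <:].
HB.instance Definition _ := [SubChoice_isSubComNzRing of OK by <:].

(* The ideal 2 O_K, written m_K for unramified K. *)
Definition mK : {pred OK} := fun x => `[< exists y, x = 2 * y >].
(* O_K is local, so that its maximal ideal is the set of its non-units;
   unramified means that this ideal is generated by the uniformizer 2 of Z_2. *)
Definition unramified : Prop :=
  forall x : OK, x \in mK <-> ~ (exists y, y * x = 1).

(* The square of the principal ideal m_K = (2) is the ideal (2 ^+ 2). *)
Definition mK2 : {pred OK} := fun x => `[< exists y, x = 2 ^+ 2 * y >].

Lemma mK2_idealr : idealr_closed mK2.
Proof.
split.
- by apply/asboolP; exists 0; rewrite mulr0.
- apply/negP => /asboolP [y e].
  have {e} e : 1 = 2 ^+ 2 * val y :> K.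
    by move: (congr1 val e); rewrite rmorph1 rmorphM rmorphXn rmorph_nat.
  have /asboolP [p pmon /rootP] := OKP y.
  rewrite -[OKval y]/(val y); set z := val y in e * => pz.
  pose m := (size p).-1.
  have sp : size p = m.+1.
    by rewrite /m prednK // lt0n size_poly_eq0 monic_neq0.
  have : Z2_to K (\sum_(i < m.+1) p`_i * (2 ^+ 2) ^+ (m - i)) = 0.
    transitivity ((2 ^+ 2) ^+ m * (map_poly (Z2_to K) p).[z]); last first.
      by rewrite pz mulr0.
    rewrite rmorph_sum horner_coef.
    rewrite size_map_poly_id0 ?sp; last first.
      by rewrite (monicP pmon) rmorph1 oner_neq0.
    rewrite mulr_sumr. apply: eq_bigr => i _.
    rewrite coef_map rmorphM !rmorphXn rmorph_nat mulrCA; congr (_ * _).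
    have le_im : (i <= m)%N by rewrite -ltnS.
    have -> : (2 ^+ 2) ^+ m = (2 ^+ 2) ^+ (m - i) * (2 ^+ 2) ^+ i :> K.
      by rewrite -exprD subnK.
    by rewrite -mulrA -[_ ^+ i * _]exprMn -e expr1n mulr1.
  rewrite -(rmorph0 (@Z2_to K)) => /Z2_to_inj.
  rewrite big_ord_recr /= subnn expr0 mulr1.
  rewrite (_ : p`_m = 1); last by rewrite -(monicP pmon).
  move=> /(congr1 (fun x : Z2 => x 0)).
  have z2D (a b : Z2) : (a + b) 0 = a 0 + b 0 by [].
  have z2M (a b : Z2) : (a * b) 0 = a 0 * b 0 by [].
  rewrite z2D (_ : z2seq (\sum_(i < m) _) 0 = 0).
    by rewrite add0r => /eqP; rewrite (oner_eq0 'Z_(2 ^ 1)).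
  elim/big_ind: _ => // [a b ea eb|i _]; first by rewrite z2D ea eb addr0.
  have -> : (m - i = (m - i).-1.+1)%N by rewrite prednK // subn_gt0.
  rewrite z2M exprS z2M (_ : (2 ^+ 2 : Z2) 0 = 0) ?mul0r ?mulr0 //.
  exact/val_inj.
- move=> a u v /asboolP [x ->] /asboolP [y ->]; apply/asboolP.
  by exists (a * x + y); rewrite mulrDr mulrCA.
Qed.
HB.instance Definition _ := isIdealr.Build OK mK2 mK2_idealr.

Definition RK := {ideal_quot mK2}.
HB.instance Definition _ := GRing.ComNzRing.on RK.
End RingOfIntegers.

(* The n-th exterior power of M: the free R-module on M^n divided by the
   relations of n-linear alternating maps. *)
Section ExteriorPower.
Variables (R : comNzRingType) (M : lmodType R) (n : nat).

Local Notation tup := {ffun 'I_n -> M}.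
Local Notation formal := {freeg tup / R}.

Definition upd (m : tup) (i : 'I_n) (u : M) : tup :=
  [ffun j => if j == i then u else m j].

Inductive ext_rel : formal -> Prop :=
| ext_rel_lin (m : tup) i a u v :
    ext_rel (<< upd m i (a *: u + v) >> - a *: << upd m i u >> - << upd m i v >>)
| ext_rel_alt (m : tup) i j : i != j -> m i = m j -> ext_rel << m >>
| ext_rel0 : ext_rel 0
| ext_relP a x y : ext_rel x -> ext_rel y -> ext_rel (a *: x + y).

Definition ext_relb : {pred formal} := fun x => `[< ext_rel x >].

Lemma ext_relb_zmod : zmod_closed ext_relb.
Proof.
split; first by apply/asboolP; apply: ext_rel0.
move=> x y /asboolP hx /asboolP hy; apply/asboolP.
by rewrite addrC -scaleN1r; apply: ext_relP.
Qed.
HB.instance Definition _ :=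
  GRing.isZmodClosed.Build formal ext_relb ext_relb_zmod.

Definition extpow := Quotient.quot ext_relb.
HB.instance Definition _ := GRing.Zmodule.on extpow.

Definition ext_class (x : formal) : extpow := \pi_(Quotient.quot ext_relb)%qT x.

Lemma ext_classP (x y : formal) : ext_class x = ext_class y <-> ext_rel (x - y).
Proof.
split=> [/eqP|h].
  by rewrite -Quotient.idealrBE => /asboolP.
by apply/eqP; rewrite -Quotient.idealrBE; apply/asboolP.
Qed.

Lemma ext_classD (x y : formal) : ext_class (x + y) = ext_class x + ext_class y.
Proof. exact: raddfD. Qed.
Lemma ext_class_repr (w : extpow) : ext_class (repr w) = w.
Proof. exact: reprK. Qed.

Definition ext_scale (a : R) (w : extpow) : extpow := ext_class (a *: repr w).

Lemma ext_scaleE a x : ext_scale a (ext_class x) = ext_class (a *: x).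
Proof.
apply/ext_classP; rewrite -scalerBr -[_ *: _]addr0; apply: ext_relP.
  by apply/ext_classP; rewrite ext_class_repr.
exact: ext_rel0.
Qed.

Lemma ext_scaleA a b w : ext_scale a (ext_scale b w) = ext_scale (a * b) w.
Proof. by rewrite -(ext_class_repr w) !ext_scaleE scalerA. Qed.
Lemma ext_scale1 : left_id 1 ext_scale.
Proof. by move=> w; rewrite -(ext_class_repr w) ext_scaleE scale1r. Qed.
Lemma ext_scaleDr : right_distributive ext_scale +%R.
Proof.
move=> a v w; rewrite -(ext_class_repr v) -(ext_class_repr w) -ext_classD.
by rewrite !ext_scaleE scalerDr ext_classD.
Qed.
Lemma ext_scaleDl w : {morph ext_scale^~ w : a b / a + b}.
Proof.
by move=> a b; rewrite -(ext_class_repr w) !ext_scaleE scalerDl ext_classD.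
Qed.
HB.instance Definition _ := GRing.Zmodule_isLmodule.Build R extpow
  ext_scaleA ext_scale1 ext_scaleDr ext_scaleDl.

Definition wedge (m : tup) : extpow := ext_class << m >>.

Definition multilinear (W : lmodType R) (f : tup -> W) := forall (m : tup) i a u v,
  f (upd m i (a *: u + v)) = a *: f (upd m i u) + f (upd m i v).
Definition alternating (W : lmodType R) (f : tup -> W) :=
  forall (m : tup) i j, i != j -> m i = m j -> f m = 0.

(* The linear map on extpow induced by a multilinear alternating f. *)
Definition ext_lift (W : lmodType R) (f : tup -> W) (w : extpow) : W :=
  fglift f (repr w).

Lemma fgliftP (W : lmodType R) (f : tup -> W) a (x y : formal) :
  fglift f (a *: x + y) = a *: fglift f x + fglift f y.
Proof.
have liftB := lift_is_additive f.
have lift0 : fglift f 0 = 0 by have := liftB 0 0; rewrite !subrr.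
have liftD u v : fglift f (u + v) = fglift f u + fglift f v.
  by rewrite -[v in LHS]opprK -[- v]sub0r !liftB lift0 sub0r opprK.
rewrite liftD; congr (_ + _).
rewrite -{2}[x]freeg_sumE.
have -> : a *: x = \sum_(z <- dom x) << a * coeff z x *g z >> by [].
elim: (dom x) => [|z s IH]; first by rewrite !big_nil lift0 scaler0.
by rewrite !big_cons !liftD IH scalerDr !liftU scalerA.
Qed.

Lemma ext_lift_class (W : lmodType R) (f : tup -> W) (x : formal) :
  multilinear f -> alternating f -> ext_lift f (ext_class x) = fglift f x.
Proof.
move=> fl fa.
have f0 : fglift f 0 = 0 by have := lift_is_additive f 0 0; rewrite !subrr.
have fZ b u : fglift f (b *: u) = b *: fglift f u.
  by rewrite -[b *: u in LHS]addr0 fgliftP f0 addr0.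
have ker z : ext_rel z -> fglift f z = 0.
  elim=> [m i a u v|m i j nij mij||a u v _ eu _ ev] //.
  - rewrite !(lift_is_additive f) fZ.
    by rewrite !liftU !scale1r fl addrAC addrK subrr.
  - by rewrite liftU scale1r (fa _ _ _ nij mij).
  - by rewrite fgliftP eu ev scaler0 addr0.
apply/eqP; rewrite -subr_eq0 -(lift_is_additive f); apply/eqP/ker/ext_classP.
by rewrite ext_class_repr.
Qed.

Lemma ext_liftE (W : lmodType R) (f : tup -> W) (m : tup) :
  multilinear f -> alternating f -> ext_lift f (wedge m) = f m.
Proof. by move=> fl fa; rewrite ext_lift_class // liftU scale1r. Qed.

Lemma ext_lift_linear (W : lmodType R) (f : tup -> W) a x y :
  multilinear f -> alternating f ->
  ext_lift f (a *: x + y) = a *: ext_lift f x + ext_lift f y.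
Proof.
move=> fl fa; rewrite -(ext_class_repr x) -(ext_class_repr y).
by rewrite [_ *: _]ext_scaleE -ext_classD !ext_lift_class // fgliftP.
Qed.
End ExteriorPower.

Definition is_basis (R : comNzRingType) (M : lmodType R) n (e : 'I_n -> M) :=
  forall x, exists! c : {ffun 'I_n -> R}, x = \sum_i c i *: e i.

Definition free_of_rank (R : comNzRingType) n (M : lmodType R) :=
  exists e : 'I_n -> M, is_basis e.

Section Submodule.
Variables (R : comNzRingType) (V : lmodType R) (L : submodClosed V).
Record submod := MkSubmod { submod_val : V; submodP : submod_val \in L }.
HB.instance Definition _ := [isSub for submod_val].
HB.instance Definition _ := [Choice of submod by <:].
HB.instance Definition _ := [SubChoice_isSubLmodule of submod by <:].
End Submodule.

Section Lagrangian.
Variables (R : comNzRingType) (V : lmodType R) (omega : {biscalar V}).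

(* Alternating, and perfect: v |-> omega v is a bijection onto the dual. *)
Definition symplectic :=
  (forall v, omega v v = 0) /\
  (forall f : {scalar V}, exists! v, forall w, omega v w = f w).

Definition lagrangian (L : submodClosed V) :=
  forall v, v \in L <-> (forall w, w \in L -> omega v w = 0).

Definition general_position (M L : submodClosed V) :=
  forall v, exists m l, [/\ m \in M, l \in L & v = m + l].

(* Oriented Lagrangians; orientP says that orient generates the n-th exterior
   power of lag. *)
Record olag n := OLag {
  lag :> submodClosed V;
  lagP : lagrangian lag;
  lag_free : free_of_rank n (submod lag);
  orient : extpow (submod lag) n;
  orientP : forall w, exists a, w = a *: orient }.

(* See omega_wedgeE for its value on decomposable elements. *)
Definition omega_wedge n (L M : submodClosed V)
    (x : extpow (submod L) n) (y : extpow (submod M) n) : R :=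
  ext_lift (fun l => ext_lift (fun m =>
    \det (\matrix_(i, j) omega (val (l i)) (val (m j))) : R^o) y : R^o) x.

(* The x in N with x - v in L. It exists and is unique for every v when N and L
   are Lagrangians in general position; restricted to M it is the map r^L. *)
Definition along (N L : submodClosed V) (v : V) : submod N :=
  xget 0 [set x : submod N | val x - v \in L].

Definition omega_along (N M L : submodClosed V) (m1 m2 : submod M) : R :=
  omega (val (along N L (val m1))) (val m2).

End Lagrangian.

Section OmegaWedgeE.
Variables (R : comNzRingType) (V : lmodType R) (omega : {biscalar V}) (n : nat).
Variables L M : submodClosed V.

Local Notation pairing_det l m :=
  (\det (\matrix_(i < n, j < n) omega (val (l i)) (val (m j)))).

Lemma pairing_det_multilinearl (m : {ffun 'I_n -> submod M}) :
  multilinear (fun l : {ffun 'I_n -> submod L} => pairing_det l m : R^o).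
Proof.
move=> l i a u v; rewrite -[X in _ = _ + X]mul1r.
apply: (determinant_multilinear (i0 := i)).
- apply/rowP=> j; rewrite !mxE !ffunE eqxx /= mul1r.
  by rewrite [omega _ _]linearPl.
- by apply/matrixP=> k j; rewrite !mxE !ffunE eq_sym (negPf (neq_lift _ _)).
- by apply/matrixP=> k j; rewrite !mxE !ffunE eq_sym (negPf (neq_lift _ _)).
Qed.

Lemma pairing_det_alternatingl (m : {ffun 'I_n -> submod M}) :
  alternating (fun l : {ffun 'I_n -> submod L} => pairing_det l m : R^o).
Proof.
move=> l i j nij lij; apply: (determinant_alternate nij) => k.
by rewrite !mxE lij.
Qed.

Lemma pairing_det_multilinearr (l : {ffun 'I_n -> submod L}) :
  multilinear (fun m : {ffun 'I_n -> submod M} => pairing_det l m : R^o).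
Proof.
move=> m i a u v; rewrite -[X in _ = _ + X]mul1r -[LHS]det_tr.
rewrite -[in X in _ = X + _]det_tr -[in X in _ = _ + X]det_tr.
apply: (determinant_multilinear (i0 := i)).
- apply/rowP=> j; rewrite !mxE !ffunE eqxx /= mul1r.
  by rewrite [omega _ _]linearPr.
- by apply/matrixP=> k j; rewrite !mxE !ffunE eq_sym (negPf (neq_lift _ _)).
- by apply/matrixP=> k j; rewrite !mxE !ffunE eq_sym (negPf (neq_lift _ _)).
Qed.

Lemma pairing_det_alternatingr (l : {ffun 'I_n -> submod L}) :
  alternating (fun m : {ffun 'I_n -> submod M} => pairing_det l m : R^o).
Proof.
move=> m i j nij mij; rewrite -[LHS]det_tr.
by apply: (determinant_alternate nij) => k; rewrite !mxE mij.
Qed.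

Lemma omega_wedgeE (l : {ffun 'I_n -> submod L}) (m : {ffun 'I_n -> submod M}) :
  omega_wedge omega (wedge l) (wedge m) = pairing_det l m.
Proof.
rewrite /omega_wedge; under [X in ext_lift X]funext => l' do
  rewrite (ext_liftE _ (pairing_det_multilinearr l') (pairing_det_alternatingr l')).
by rewrite ext_liftE //; [apply: pairing_det_multilinearl
  | apply: pairing_det_alternatingl].
Qed.
End OmegaWedgeE.

(* A commutative ring R of characteristic 4 is a module over Z/4 through
   natural-number multiples: x *+ c for c : 'Z_4. *)
Section Trace.
Variable R : comNzRingType.

Definition is_basis4 d (e : 'I_d -> R) :=
  forall x, exists! c : {ffun 'I_d -> 'Z_4}, x = \sum_i e i *+ c i.

Definition is_trace4 (x : R) (t : 'Z_4) :=
  exists d (e : 'I_d -> R) (A : 'M['Z_4]_d), [/\ is_basis4 e,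
    forall i, x * e i = \sum_j e j *+ A i j & t = \tr A].

(* The trace over Z/4 of multiplication by x, computed in any Z/4-basis of R
   (the value 0 is a default for rings that have no finite Z/4-basis). *)
Definition trace4 (x : R) : 'Z_4 := xget 0 (is_trace4 x).
End Trace.

Section GaussSum.
Variable (T : realType).

(* e^(2 pi i k / 4). *)
Definition expi4 (k : 'Z_4) : T[i] :=
  let t := 2 * pi / 4 * (k : nat)%:R in (cos t +i* sin t)%C.

Section TwiceW.
Variable W : zmodType.
Definition twice : {pred W} := fun x => `[< exists y, x = y *+ 2 >].

Lemma twice_zmod : zmod_closed twice.
Proof.
split; first by apply/asboolP; exists 0; rewrite mul0rn.
move=> x y /asboolP[u ->] /asboolP[v ->]; apply/asboolP.
by exists (u - v); rewrite mulrnBl.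
Qed.
HB.instance Definition _ := GRing.isZmodClosed.Build W twice twice_zmod.
End TwiceW.

(* Only the group structure of W and the form B enter the sum. When W is finite,
   which holds in the intended case, the sum over W/2W is an actual finite sum;
   B (v, v) does not depend on the representative v for bilinear symmetric B. *)
Definition gauss (W : zmodType) (B : W -> W -> 'Z_4) : T[i] :=
  \sum_(w \in [set: Quotient.quot (@twice W)]) expi4 (B (repr w) (repr w)).

(* The m-fold orthogonal direct sum m[W, B]. *)
Definition orthosum m (W : zmodType) (B : W -> W -> 'Z_4)
  (x y : {ffun 'I_m -> W}) : 'Z_4 := \sum_i B (x i) (y i).

(* x_1 y_1 + ... + x_(n-1) y_(n-1) + c x_n y_n. *)
Definition diag_last (R : comNzRingType) n (c : R) (x y : 'rV[R]_n) : R :=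
  \sum_(i < n) (if i.+1 == n then c else 1) * x 0 i * y 0 i.

(* A_(M,L); note that omega_wedge takes the orientation of L first. *)
Definition Acoef (R : comNzRingType) (V : lmodType R) (omega : {biscalar V}) n
    (M L : olag omega n) : T[i] :=
  gauss (orthosum (m := 2) (fun x y : 'rV[R]_n =>
    trace4 (diag_last (omega_wedge omega (orient L) (orient M)) x y))).

End GaussSum.

(* Main.v *)
Require Import Defs.
From HB Require Import structures.
From mathcomp Require Import all_boot all_order all_algebra all_field.
From mathcomp Require Import boolp classical_sets fsbigop reals trigo.
From mathcomp Require Import complex freeg.
From mathcomp Require Import perm ring.

(** Write R for O_K/4 and psi for the additive character x |-> i^(tr x). Doubling a form is what makes its Gauss sum computable:
in the square of S(B) = sum over x of psi(B(x,x)), substituting y = x + z turns the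
exponent into B(z,z) + 2 B(x,x) + 2 B(x,z). Because tr(x^2) = tr(x) modulo 2, the
map x |-> psi(2 B(x,x)) is an additive character, say x |-> psi(2 B(x,w)), so summing
over x leaves only the z congruent to w modulo 2, and S(B)^2 is a positive integer
times psi(B(w,w)) ([gsum_sqr]).

For the rank one form with coefficient s^2 (1 + 2 u) this gives S^2 = kappa psi(2 u),
and every unit of R has that shape because squaring is bijective modulo 2. Hence
chi(s^2 (1 + 2 u)) = psi(2 u) is a character of the units ([chiM]). Cutting an
arbitrary unimodular symmetric matrix into 1x1 blocks with a unit entry and 2x2 blocks
with even diagonal by Schur complements gives

   S(B)^2 = kappa^n chi(det B)                              ([det_law_unimodular]).

So the doubled Gauss sum only sees the rank and the class of the determinant, and the
theorem becomes an identity between determinants, up to squares of units. Choose bases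
of N, M and L. The basis of each Lagrangian wedges to a unit multiple of the
orientation, so the pairings of the orientations are, up to units, the determinants
of the three pairing matrices ([wedge_gram]). Let (m,e) stand for the matrix of the
omega(m_i, e_j), for bases m of M and e of N, and so on. The matrix of -omega_L is
rho (m,e)^T with rho the matrix of r^L, and rho (l,e)^T = (l,m)^T ([det_maslov]).
The units that the change of basis brings in cancel, except for the square of the one
that belongs to M.

Two facts about the trace enter: it is not zero modulo 2, and tr(x^2) = tr(x)
modulo 2. Both follow from tr = x + x^2 + x^4 + ... modulo 2 ([tr_mul_frob]). When R has
no finite basis over Z/4, the trace is 0 by convention, so every form is 0 and the
theorem holds because the underlying modules are isomorphic. *)

Import GRing.Theory Num.Theory.
Local Open Scope ring_scope.
Set Implicit Arguments.
Unset Strict Implicit.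
Unset Printing Implicit Defensive.

(** * Rings in which four vanishes *)

Lemma twiceP (W : zmodType) (x : W) :
  reflect (exists y, x = y *+ 2) (x \in @twice W).
Proof. exact: asboolP. Qed.

Lemma twiceM (R : comNzRingType) (x y : R) :
  x \in @twice R -> y * x \in @twice R.
Proof.
by case/twiceP => z ->; apply/twiceP; exists (y * z); rewrite mulrnAr.
Qed.

Section CharacteristicFour.
Variable R : comNzRingType.
Hypothesis R4 : 4%:R = 0 :> R.

Lemma mulrn4 (x : R) : x *+ 2 *+ 2 = 0.
Proof. by rewrite -mulrnA -mulr_natr R4 mulr0. Qed.

Lemma unit_ntwice (x y : R) : y * x = 1 -> x \notin @twice R.
Proof.
move=> yx1; apply/negP => /twiceP[z xz].
have : (1 : R) = 0.
  rewrite -[1]mulr1 -{1}yx1 xz -{1}yx1 xz !mulrnAr !mulrnAl.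
  exact: mulrn4.
by move/eqP; rewrite oner_eq0.
Qed.

Definition Z4_to (c : 'Z_4) : R := (c : nat)%:R.

Lemma natr_mod4 m : (m %% 4)%:R = m%:R :> R.
Proof. by rewrite [in RHS](divn_eq m 4) natrD natrM R4 mulr0 add0r. Qed.

Lemma Z4_to_zmod : zmod_morphism Z4_to.
Proof.
move=> a b; apply/eqP; rewrite eq_sym subr_eq -natrD; apply/eqP.
by rewrite -[in LHS](subrK b a) -natr_mod4.
Qed.

Lemma Z4_to_monoid : monoid_morphism Z4_to.
Proof. by split=> // a b; rewrite /Z4_to -natrM -[RHS]natr_mod4. Qed.

Lemma Z4_morph : exists zeta : {rmorphism 'Z_4 -> R}, forall c, zeta c = (c : nat)%:R.
Proof.
pose zeta : {rmorphism 'Z_4 -> R} := HB.pack Z4_to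
  (GRing.isZmodMorphism.Build _ _ Z4_to Z4_to_zmod)
  (GRing.isMonoidMorphism.Build _ _ Z4_to Z4_to_monoid).
by exists zeta.
Qed.
End CharacteristicFour.

(** * Quadratic Gauss sums over a finite local ring *)

Section BilinearForm.
Variable R : comNzRingType.

Definition bil n (B : 'M[R]_n) (x y : 'rV[R]_n) : R := (x *m B *m y^T) 0 0.

Lemma bilDl n (B : 'M[R]_n) x y z : bil B (x + y) z = bil B x z + bil B y z.
Proof. by rewrite /bil !mulmxDl [LHS]mxE. Qed.

Lemma bilDr n (B : 'M[R]_n) x y z : bil B z (x + y) = bil B z x + bil B z y.
Proof. by rewrite /bil linearD mulmxDr [LHS]mxE. Qed.

Lemma bil_sym n (B : 'M[R]_n) x y : B^T = B -> bil B x y = bil B y x.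
Proof.
by move=> Bs; rewrite /bil -[in RHS]Bs -[y in RHS]trmxK -mulmxA -!trmx_mul [RHS]mxE mulmxA.
Qed.

Hypothesis R4 : 4%:R = 0 :> R.

(** The quadratic form B(x,x) descends to W/2W: the cross terms pair up to multiples
of four. *)
Lemma bil_shift n (B : 'M[R]_n) x v : B^T = B ->
  bil B (x + v *+ 2) (x + v *+ 2) = bil B x x.
Proof.
move=> Bs; rewrite mulr2n !(bilDl, bilDr) !(bil_sym x v Bs).
set a := bil B x x; set b := bil B v x; set c := bil B v v.
have -> : a + (b + b) + (b + (c + c) + (b + (c + c))) = a + 4%:R * (b + c) by ring.
by rewrite R4 mul0r addr0.
Qed.
End BilinearForm.

Section QuadraticGaussSums.
Variables (R : finComNzRingType) (C : numFieldType) (psi : R -> C).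
Hypothesis R4 : 4%:R = 0 :> R.
Hypothesis Rloc : forall x : R, x \in @twice R \/ (exists y, y * x = 1).
Hypothesis psi0 : psi 0 = 1.
Hypothesis psiD : forall x y, psi (x + y) = psi x * psi y.
(* x |-> psi(2 x) is invariant under Frobenius, like the trace of the residue field. *)
Hypothesis psiF : forall x, psi (x ^+ 2 *+ 2) = psi (x *+ 2).
Hypothesis psiN : exists x, psi (x *+ 2) != 1.

Definition gsum n (B : 'M[R]_n) : C := \sum_(x : 'rV[R]_n) psi (bil B x x).

Lemma psi_neq0 x : psi x != 0.
Proof.
apply/eqP => e; have := psiD x (- x); rewrite subrr psi0 e mul0r => /eqP.
by rewrite oner_eq0.
Qed.

(** Orthogonality of characters: a coefficient of c that is not even is a unit, and
then the values x c fill the ring, on which psi(2 x) is not constant. *)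
Lemma sum_char n (c : 'cV[R]_n) :
  \sum_(x : 'rV[R]_n) psi ((x *m c) 0 0 *+ 2) =
  if [forall i, c i 0 \in @twice R] then #|{: 'rV[R]_n}|%:R else 0.
Proof.
case: ifP => [/forallP ce|/negbT/forallPn[i ci]].
  rewrite (eq_bigr (fun _ => 1)) ?sumr_const // => x _.
  rewrite mxE -sumrMnl big1 // => i _.
  by have /twiceP[y ->] := ce i; rewrite mulrnAr (mulrn4 R4).
have [x0 hx0] := psiN.
have [/(negP ci) // | [y yc]] := Rloc (c i 0).
pose w : 'rV[R]_n := (x0 * y) *: delta_mx 0 i.
have wc : (w *m c) 0 0 = x0.
  rewrite -scalemxAl mxE -rowE mxE -mulrA yc mulr1 //.
set S := LHS; have : S = psi (x0 *+ 2) * S.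
  rewrite {1}/S (reindex_inj (addrI w)) mulr_sumr; apply: eq_bigr => x _.
  by rewrite -psiD -wc -mulrnDl mulmxDl mxE.
move/eqP; rewrite -subr_eq0 -[X in X - _]mul1r -mulrBl mulf_eq0 subr_eq0.
by rewrite eq_sym (negPf hx0) => /eqP.
Qed.

Definition even_rows n := [pred z : 'rV[R]_n | [forall i, z 0 i \in @twice R]].

(** The vector w is a characteristic vector of the form B modulo 2: it represents the
additive map psi(2 B(x,x)). Only the z in the class of w modulo 2 survive in the double
sum, and B(z,z) is constant on that class. *)
Lemma gsum_sqr n (B B' : 'M[R]_n) w :
    B^T = B -> B' *m B = 1%:M ->
    (forall x, psi (bil B x x *+ 2) = psi (bil B x w *+ 2)) ->
  gsum B ^+ 2 =
    #|{: 'rV[R]_n}|%:R * #|even_rows n|%:R * psi (bil B w w).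
Proof.
move=> Bs BB hw.
have -> : gsum B ^+ 2 = \sum_(x : 'rV[R]_n) \sum_(z : 'rV[R]_n)
    psi (bil B z z) * psi ((x *m (B *m (w + z)^T)) 0 0 *+ 2).
  rewrite expr2 /gsum mulr_suml; apply: eq_bigr => x _.
  rewrite mulr_sumr (reindex_inj (addrI x)); apply: eq_bigr => z _.
  rewrite mulmxA -/(bil B x (w + z)) bilDr mulrnDl psiD -hw -!psiD.
  rewrite !(bilDl, bilDr) (bil_sym z x Bs) !mulr2n; congr psi.
  by rewrite -!addrA [RHS]addrCA; congr (_ + _); rewrite [RHS]addrC !addrA.
rewrite exchange_big /=.
under eq_bigr => z _ do rewrite -mulr_sumr sum_char.
have evB z : [forall i, (B *m (w + z)^T) i 0 \in @twice R] =
    (w + z \in even_rows n).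
  have ev (D : 'M[R]_n) (u : 'cV[R]_n) : (forall i, u i 0 \in @twice R) ->
      forall i, (D *m u) i 0 \in @twice R.
    by move=> hu i; rewrite mxE; apply: rpred_sum => j _; apply: twiceM.
  apply/forallP/forallP => h i.
    have := ev B' _ h i; rewrite mulmxA BB mul1mx.
    by rewrite [_^T _ _]mxE.
  by apply: ev => j; rewrite mxE; apply: h.
under eq_bigr => z _ do rewrite evB.
(* From now on z is the deviation from the class of -w, which is that of w. *)
rewrite (reindex_inj (addrI (- w))) /=.
under eq_bigr => z _ do rewrite addrA subrr add0r.
rewrite (bigID (fun z => z \in even_rows n)) /= [X in _ + X]big1 ?addr0; last first.
  by move=> z /negPf ->; rewrite mulr0.
rewrite (eq_bigr (fun _ => psi (bil B w w) * #|{: 'rV[R]_n}|%:R)).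
  by rewrite sumr_const -[_ *+ _]mulr_natr -mulrA [RHS]mulrC.
move=> z ze; rewrite ze; congr (psi _ * _).
have [v ->] : exists v, z = v *+ 2.
  exists (\row_i xget 0 [set y | z 0 i = y *+ 2]).
  apply/rowP => i; rewrite mulr2n !mxE -mulr2n.
  have /twiceP := forallP ze i.
  by move/(@xgetPex _ 0).
by rewrite (bil_shift R4) // /bil linearN /= mulmxN !mulNmx opprK.
Qed.

Lemma gsum_congr n (B P P' : 'M[R]_n) : P' *m P = 1%:M ->
  gsum (P *m B *m P^T) = gsum B.
Proof.
move=> PP; have PP2 := mulmx1C PP.
rewrite /gsum [RHS](reindex (fun x : 'rV[R]_n => x *m P)).
  by apply: eq_bigr => x _; rewrite /bil trmx_mul !mulmxA.
exists (fun x => x *m P') => x _; first by rewrite -mulmxA PP2 mulmx1.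
by rewrite -mulmxA PP mulmx1.
Qed.

Lemma gsum_block m n (A : 'M[R]_m) (D : 'M[R]_n) :
  gsum (block_mx A 0 0 D) = gsum A * gsum D.
Proof.
rewrite /gsum mulr_suml; under [RHS]eq_bigr => x _ do rewrite mulr_sumr.
rewrite pair_big /= (reindex (fun p : 'rV[R]_m * 'rV[R]_n => row_mx p.1 p.2)).
  apply: eq_bigr => -[x y] _ /=; rewrite -psiD /bil mul_row_block !mulmx0.
  by rewrite addr0 add0r tr_row_mx mul_row_col mxE.
exists (fun x => (lsubmx x, rsubmx x)) => x _; last by rewrite hsubmxK.
by rewrite row_mxKl row_mxKr; case: x.
Qed.

(** The squared Gauss sum of the unit form, and the sign by which the squared Gauss sum
of the rank one form with coefficient a differs from it (a sign, if a is a unit). *)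
Definition kappa := gsum (1%:M : 'M[R]_1) ^+ 2.
Definition chi (a : R) := gsum (a%:M : 'M[R]_1) ^+ 2 / kappa.

Lemma bil11 (a : R) (x y : 'rV[R]_1) : bil a%:M x y = a * x 0 0 * y 0 0.
Proof.
by rewrite /bil mul_mx_scalar -scalemxAl !mxE big_ord1 !mxE mulrA.
Qed.

Lemma gsum_odd (u : R) : gsum ((1 + u *+ 2)%:M : 'M[R]_1) ^+ 2 =
  #|{: 'rV[R]_1}|%:R * #|even_rows 1|%:R * psi (1 + u *+ 2).
Proof.
have u2 : (1 + u *+ 2) *+ 2 = 2%:R by rewrite mulrnDl (mulrn4 R4) addr0.
have uu : (1 + u *+ 2) * (1 + u *+ 2) = 1.
  rewrite mulrDl mul1r mulrnAl mulrDr mulr1 mulrnAr mulrnDl (mulrn4 R4) addr0.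
  by rewrite -addrA -mulr2n (mulrn4 R4) addr0.
rewrite (@gsum_sqr _ _ (1 + u *+ 2)%:M 1%:M).
- by rewrite bil11 !mxE eqxx !mulr1.
- exact: tr_scalar_mx.
- by rewrite -scalar_mxM uu.
- move=> x; rewrite !bil11 !mxE eqxx mulr1 -!mulrA -!mulrnAl u2.
  by rewrite -expr2 !mulr_natl psiF.
Qed.

Lemma kappaE : kappa = #|{: 'rV[R]_1}|%:R * #|even_rows 1|%:R * psi 1.
Proof. by have := gsum_odd 0; rewrite mul0rn addr0. Qed.

Lemma kappa_neq0 : kappa != 0.
Proof.
rewrite kappaE !mulf_neq0 ?psi_neq0 // pnatr_eq0 -lt0n; apply/card_gt0P.
  by exists 0.
exists 0; apply/forallP => i; rewrite mxE; exact: rpred0.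
Qed.

Lemma chi_odd (u : R) : chi (1 + u *+ 2) = psi (u *+ 2).
Proof.
rewrite /chi gsum_odd psiD; have := kappa_neq0; rewrite kappaE => k0.
by rewrite mulrA mulrAC mulfV ?mul1r.
Qed.

Lemma chi1 : chi 1 = 1.
Proof. by have := chi_odd 0; rewrite mul0rn addr0 psi0. Qed.

Lemma chi_sqr (s s' a : R) : s' * s = 1 -> chi (s ^+ 2 * a) = chi a.
Proof.
move=> ss; rewrite /chi; congr (_ ^+ 2 / _).
rewrite -[RHS](@gsum_congr _ _ s%:M s'%:M); last by rewrite -scalar_mxM ss.
by rewrite tr_scalar_mx -!scalar_mxM [s * a * s]mulrAC expr2.
Qed.

(** Squaring is injective modulo 2, hence bijective since the ring is finite; so a unit
is a square modulo 2. A square root is found as a power of a: the sequence of the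
a^(2^i) repeats itself, and by injectivity it repeats from the start. *)
Lemma unit_sqr (a b : R) : b * a = 1 ->
  exists s s' u, s' * s = 1 /\ a = s ^+ 2 * (1 + u *+ 2).
Proof.
move=> ba.
have sq_inj (x y : R) : x ^+ 2 - y ^+ 2 \in @twice R -> x - y \in @twice R.
  case/twiceP => t xy; case: (Rloc (x - y)) => // -[z zxy].
  suff : (x - y) ^+ 2 \in @twice R.
    apply: contraLR => _; apply: (@unit_ntwice _ R4 _ (z ^+ 2)).
    by rewrite -exprMn zxy expr1n.
  apply/twiceP; exists (t - y * (x - y)); rewrite mulrnBl -xy; ring.
have [i [m [m0 eim]]] : exists i m, (0 < m)%N /\ a ^+ (2 ^ i) = a ^+ (2 ^ (i + m)).
  pose f (i : 'I_#|R|.+1) := a ^+ (2 ^ i).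
  have /injectivePn[i [j nij eij]] : ~~ injectiveb f.
    by apply/injectiveP => /leq_card; rewrite card_ord ltnn.
  case: (ltngtP i j) => [ij|ij|/val_inj eq_ij]; last by rewrite eq_ij eqxx in nij.
    by exists i, (j - i)%N; rewrite subn_gt0 subnKC // ltnW.
  by exists j, (i - j)%N; rewrite subn_gt0 subnKC // ltnW.
have : a ^+ (2 ^ i) - a ^+ (2 ^ (i + m)) \in @twice R by rewrite eim subrr rpred0.
elim: i {eim} => [|i IHi]; last by rewrite addSn !expnS !(mulnC 2%N) !exprM => /sq_inj.
rewrite add0n expn0 expr1 -(prednK m0) expnS mulnC exprM.
set s := a ^+ _ => /twiceP[t at2].
pose s' := b ^+ (2 ^ m.-1).
have ss : s' * s = 1 by rewrite -exprMn ba expr1n.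
exists s, s', (s' ^+ 2 * t); split=> //.
rewrite mulrDr mulr1 mulrnAr mulrA -exprMn [s * _]mulrC ss expr1n mul1r -at2.
by rewrite addrC subrK.
Qed.

(** Units congruent to 1 modulo 2 multiply by adding: (1 + 2 u)(1 + 2 v) is
1 + 2 (u + v) modulo 4. *)
Lemma chiM (a a' b b' : R) : a' * a = 1 -> b' * b = 1 ->
  chi (a * b) = chi a * chi b.
Proof.
move=> /unit_sqr[s [s' [u [ss ->]]]] /unit_sqr[t [t' [v [tt ->]]]].
rewrite (chi_sqr _ ss) (chi_sqr _ tt) !chi_odd -psiD -mulrnDl -chi_odd.
rewrite mulrACA -exprMn (@chi_sqr _ (s' * t')); last by rewrite mulrACA ss tt mulr1.
congr chi.
have -> : (1 + u *+ 2) * (1 + v *+ 2) = 1 + (u + v) *+ 2 + 4%:R * (u * v) by ring.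
by rewrite R4 mul0r addr0.
Qed.

(** The doubled Gauss sum of B depends only on its rank and its determinant. *)
Definition det_law n (B : 'M[R]_n) := gsum B ^+ 2 = kappa ^+ n * chi (\det B).

Lemma det_law_congr n (B P P' : 'M[R]_n) : P' *m P = 1%:M ->
  det_law (P *m B *m P^T) -> det_law B.
Proof.
move=> PP; rewrite /det_law (gsum_congr _ PP) !det_mulmx det_tr mulrAC -expr2.
by rewrite (@chi_sqr _ (\det P')) // -det_mulmx PP det1.
Qed.

Lemma det_law1 (A : 'M[R]_1) : det_law A.
Proof.
rewrite /det_law /chi det_mx11 -mx11_scalar expr1 mulrCA mulfV ?mulr1 //.
exact: kappa_neq0.
Qed.

Lemma schur_congr m n (A A' : 'M[R]_m) (b : 'M[R]_(m, n)) (D : 'M[R]_n) :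
    A^T = A -> A' *m A = 1%:M ->
  exists P P' : 'M[R]_(m + n), [/\ P' *m P = 1%:M, \det P = 1 &
    P *m block_mx A b b^T D *m P^T = block_mx A 0 0 (D - b^T *m A' *m b)].
Proof.
move=> As AA; have AA2 := mulmx1C AA.
have A's : A'^T = A'.
  have : A'^T *m A = 1%:M by rewrite -{1}As -trmx_mul AA2 trmx1.
  by move/(congr1 (mulmx^~ A')); rewrite /= -mulmxA AA2 mulmx1 mul1mx.
exists (block_mx 1%:M 0 (- (b^T *m A')) 1%:M).
exists (block_mx 1%:M 0 (b^T *m A') 1%:M); split.
- rewrite mulmx_block !(mul1mx, mulmx1, mulmx0, mul0mx, addr0, add0r) subrr.
  by rewrite -scalar_mx_block.
- by rewrite det_lblock !det1 mulr1.
- rewrite mulmx_block !(mul1mx, mul0mx, addr0) !mulNmx -(mulmxA b^T A' A) AA.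
  rewrite mulmx1 addNr tr_block_mx mulmx_block trmx0 !trmx1.
  rewrite linearN /= trmx_mul trmxK A's.
  rewrite !(mul0mx, mulmx0, mulmx1, addr0, add0r) mulmxN mulmxA AA2 mul1mx addNr.
  by rewrite addrC.
Qed.

(** Eliminating the invertible upper left block changes neither the Gauss sum nor the
determinant, and makes both multiplicative. *)
Lemma det_law_schur m n (E : 'M[R]_(m + n)) (t z : R) :
    E^T = E -> z * \det E = 1 -> t * \det (ulsubmx E) = 1 ->
    det_law (ulsubmx E) ->
    (forall (D : 'M[R]_n) y, D^T = D -> y * \det D = 1 -> det_law D) ->
  det_law E.
Proof.
set A := ulsubmx E => Es zE tA gA IH.
have As : A^T = A by rewrite trmx_ulsub Es.
have AA : (t *: \adj A) *m A = 1%:M.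
  by rewrite -scalemxAl mul_adj_mx scale_scalar_mx tA.
set b := ursubmx E; set D := drsubmx E.
have eE : block_mx A b b^T D = E by rewrite /b trmx_ursub Es submxK.
have [P [P' [PP P1]]] := schur_congr b D As AA.
rewrite eE; set F := D - _ => eP; apply: (det_law_congr PP).
have Fs : F^T = F.
  have : (P *m E *m P^T)^T = P *m E *m P^T.
    by rewrite !trmx_mul trmxK Es mulmxA.
  by rewrite eP tr_block_mx => /eq_block_mx[].
have dE : \det E = \det A * \det F.
  have := congr1 determinant eP.
  by rewrite !det_mulmx det_tr P1 mulr1 mul1r det_ublock.
have zF : z * \det A * \det F = 1 by rewrite -mulrA -dE.
rewrite eP /det_law gsum_block det_ublock exprMn gA (IH _ _ Fs zF) mulrACA -exprD.
by rewrite (chiM tA zF).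
Qed.

Definition permute n (s : 'S_n) (B : 'M[R]_n) : 'M[R]_n :=
  \matrix_(i, j) B (s i) (s j).

Lemma permuteE n (s : 'S_n) (B : 'M[R]_n) :
  permute s B = perm_mx s *m B *m (perm_mx s)^T.
Proof.
rewrite tr_perm_mx -row_permE -col_permE.
by apply/matrixP => i j; rewrite !mxE.
Qed.

Lemma perm_mxVK n (s : 'S_n) : perm_mx s^-1%g *m perm_mx s = 1%:M :> 'M[R]_n.
Proof. by rewrite -perm_mxM mulVg perm_mx1. Qed.

Lemma det_permute n (s : 'S_n) (B : 'M[R]_n) : \det (permute s B) = \det B.
Proof.
by rewrite permuteE tr_perm_mx det_mulmx mulrC -det_mulmx mulmxA perm_mxVK mul1mx.
Qed.

Lemma tr_permute n (s : 'S_n) (B : 'M[R]_n) :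
  B^T = B -> (permute s B)^T = permute s B.
Proof. by move=> Bs; apply/matrixP => i j; rewrite !mxE -{1}Bs mxE. Qed.

Lemma det_law_permute n (s : 'S_n) (B : 'M[R]_n) : det_law (permute s B) -> det_law B.
Proof. by rewrite permuteE; apply: det_law_congr; apply: perm_mxVK. Qed.

Lemma det2 (A : 'M[R]_2) : \det A = A 0 0 * A 1 1 - A 0 1 * A 1 0.
Proof.
rewrite (expand_det_row _ 0) 2!big_ord_recl big_ord0 addr0 /cofactor !det_mx11.
rewrite !mxE /= expr0 expr1 mul1r mulN1r mulrN.
by congr (A _ _ * A _ _ - A _ _ * A _ _); apply: val_inj.
Qed.

(** An even plane has characteristic vector 0 and determinant -r^2, and the constants
match: -1 = 1 + 2 in R, so chi(-1) = psi(2), while kappa^2, read off from the unit form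
of rank 2, carries the same factor psi(2), and psi(2)^2 = 1. *)
Lemma det_law_even2 (A : 'M[R]_2) (y : R) : A^T = A -> y * \det A = 1 ->
  (forall i, A i i \in @twice R) -> det_law A.
Proof.
move=> As yA Ae.
have [a ea] := twiceP _ (Ae 0); have [c ec] := twiceP _ (Ae 1).
pose r := A 0 1.
have er : A 1 0 = r by rewrite /r -{1}As mxE.
have detA : \det A = r ^+ 2 * -1.
  rewrite det2 ea ec er mulrnAr mulrnAl (mulrn4 R4) sub0r expr2 mulrN1 //.
have rr : (y * - r) * r = 1 by rewrite -yA detA; ring.
rewrite /det_law detA (chi_sqr _ rr).
have AA : (y *: \adj A) *m A = 1%:M.
  by rewrite -scalemxAl mul_adj_mx scale_scalar_mx yA.
rewrite (@gsum_sqr _ _ (y *: \adj A) 0) //; last first.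
  move=> x; rewrite [in RHS]/bil trmx0 mulmx0 mxE mul0rn psi0.
  suff -> : bil A x x *+ 2 = 0 by [].
  rewrite /bil mxE !big_ord_recl big_ord0 !mxE !big_ord_recl !big_ord0.
  rewrite ord1 (_ : fintype.lift ord0 ord0 = 1); last exact/val_inj.
  rewrite -[ord0]/(0 : 'I_2) ea ec er -/r.
  have -> : ((x 0 0 * (a *+ 2) + (x 0 1 * r + 0)) * x 0 0 +
     ((x 0 0 * r + (x 0 1 * (c *+ 2) + 0)) * x 0 1 + 0)) *+ 2 =
     4%:R * (a * x 0 0 ^+ 2 + x 0 0 * x 0 1 * r + c * x 0 1 ^+ 2) by ring.
  by rewrite R4 mul0r.
have -> : kappa ^+ 2 = #|{: 'rV[R]_2}|%:R * #|even_rows 2|%:R * psi 2%:R.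
  rewrite /kappa [X in X ^+ 2]expr2 -gsum_block -scalar_mx_block.
  (* The all-ones vector is characteristic for the unit form: psi(2 x^2) = psi(2 x). *)
  rewrite (@gsum_sqr _ _ 1%:M (const_mx 1)); first last.
  - move=> x; rewrite /bil !mulmx1 !mxE -!sumrMnl.
    rewrite 2!big_ord_recl big_ord0 addr0 2!big_ord_recl big_ord0 addr0 !mxE.
    by rewrite !mulr1 psiD -!expr2 !psiF -psiD.
  - by rewrite mulmx1.
  - exact: trmx1.
  congr (_ * psi _).
  by rewrite /bil mulmx1 mxE 2!big_ord_recl big_ord0 !mxE !mulr1 addr0.
rewrite -[RHS]mulrA; congr (_ * _).
have -> : -1 = 1 + 1 *+ 2 :> R.
  by apply/eqP; rewrite eq_sym -subr_eq0 opprK; apply/eqP; rewrite -[RHS]R4; ring.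
rewrite chi_odd -psiD /bil mul0mx mul0mx mxE psi0 -mulr2n.
by rewrite (mulrn4 R4) psi0.
Qed.

(** By induction on the rank. If the form takes a unit value on some basis vector, this
vector splits off; otherwise the diagonal is even, and since the determinant is a unit,
the first row has a unit entry elsewhere, which gives an even plane that splits off. *)
Lemma det_law_unimodular n (B : 'M[R]_n) (y : R) : B^T = B -> y * \det B = 1 -> det_law B.
Proof.
elim/ltn_ind: n B y => -[|n] IH B y Bs yB.
  rewrite /det_law det_mx00 chi1 expr0 mulr1 /gsum (big_pred1 0); last first.
    by move=> x; rewrite (thinmx0 x) /= eqxx.
  by rewrite /bil mul0mx mul0mx mxE psi0 expr1n.
have [[i Bi]|Be] := pselect (exists i, B i i \notin @twice R).
  have [/(negP Bi) // | [t tB]] := Rloc (B i i).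
  apply: (@det_law_permute _ (tperm 0 i)).
  apply: (@det_law_schur 1 n _ t y); rewrite ?tr_permute ?det_permute //.
  - rewrite det_mx11 !mxE [lshift _ _](_ : _ = 0); last exact: val_inj.
    by rewrite tpermL.
  - exact: det_law1.
  - by move=> D z; apply: IH.
have {}Be i : B i i \in @twice R.
  by apply/negPn/negP => Bi; apply: Be; exists i.
have [j Bj] : exists j, B 0 j \notin @twice R.
  apply/existsP; have := unit_ntwice R4 yB; apply: contraR => /existsPn h.
  rewrite (expand_det_row _ 0); apply: rpred_sum => j _.
  by rewrite mulrC; apply: twiceM; apply/negPn.
have j0 : j != 0 by apply: contraNneq Bj => ->.
case: n => [|n] in B y Bs yB IH Be j Bj j0 *; first by rewrite ord1 eqxx in j0.
have [/(negP Bj) // | [t tB]] := Rloc (B 0 j).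
pose s := tperm (1 : 'I_n.+2) j.
have s0 : s 0 = 0 by rewrite tpermD // eq_sym.
apply: (@det_law_permute _ s).
set E : 'M_(2 + n) := permute s B.
have Es : E^T = E by rewrite tr_permute.
have As : (ulsubmx E)^T = ulsubmx E by rewrite trmx_ulsub Es.
have Ae i : ulsubmx E i i \in @twice R by rewrite !mxE.
have A01 : ulsubmx E 0 1 = B 0 j.
  rewrite !mxE (_ : lshift n 0 = 0); last exact: val_inj.
  by rewrite (_ : lshift n 1 = 1) ?s0 ?tpermL //; apply: val_inj.
have tA : - t ^+ 2 * \det (ulsubmx E) = 1.
  have [[a ea] [b eb]] := (twiceP _ (Ae 0), twiceP _ (Ae 1)).
  rewrite det2 ea eb -{2}As [_^T 1 0]mxE A01 -[RHS](expr1n _ 2) -tB.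
  rewrite -[RHS]subr0 -(mulr0 (t ^+ 2)) -(mul0r (a * b)) -R4; ring.
apply: (det_law_schur Es _ tA); first by rewrite det_permute; apply: yB.
  exact: det_law_even2 tA Ae.
by move=> D z; apply: IH.
Qed.

End QuadraticGaussSums.

(** * The trace modulo two as a sum of Frobenius powers *)

Section FrobeniusTrace.
Variables (F : idomainType) (d : nat) (e : 'I_d -> F).
Hypothesis F2 : 2%N \in [pchar F].
(* Linear independence over the field with two elements, by its 0-1 combinations. *)
Hypothesis e_free : injective (fun b : {ffun 'I_d -> bool} => \sum_i e i *+ b i).

Lemma frobD k : {morph (fun z : F => z ^+ (2 ^ k)) : x y / x + y}.
Proof. by move=> x y; apply: exprDn_pchar; rewrite pnatX pnatE ?F2. Qed.

Lemma frob_sum k (I : finType) (f : I -> F) :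
  (\sum_i f i) ^+ (2 ^ k) = \sum_i f i ^+ (2 ^ k).
Proof.
by apply: (big_morph _ (frobD k)); rewrite expr0n expn_eq0.
Qed.

Lemma natr_bool (m : nat) : m%:R = (odd m)%:R :> F.
Proof.
rewrite -[in LHS](odd_double_half m) natrD -muln2 natrM.
by rewrite (pcharf0 F2) mulr0 addr0.
Qed.

Lemma frob_nat k (m : nat) : (m%:R : F) ^+ (2 ^ k) = m%:R.
Proof.
rewrite natr_bool; case: odd; first exact: expr1n.
by rewrite expr0n expn_eq0.
Qed.

(** A nonzero polynomial sum of v_k X^(2^k), k < d, has degree at most 2^(d-1), so it
cannot vanish at the 2^d distinct combinations of the e_i. *)
Lemma linearized_nonzero (v : 'rV[F]_d) : v != 0 ->
  exists y : F, (exists b : {ffun 'I_d -> bool}, y = \sum_i e i *+ b i) /\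
    \sum_(k < d) v 0 k * y ^+ (2 ^ k) != 0.
Proof.
move=> v0; apply: contrapT => h.
pose p : {poly F} := \sum_(k < d) v 0 k *: 'X^(2 ^ k).
have pE y : p.[y] = \sum_(k < d) v 0 k * y ^+ (2 ^ k).
  by rewrite horner_sum; apply: eq_bigr => k _; rewrite hornerZ hornerXn.
pose rs := [seq \sum_i e i *+ b i | b : {ffun 'I_d -> bool}].
have prs : all (root p) rs.
  apply/allP => y /mapP[b _ ->]; apply/rootP; rewrite pE.
  by apply/eqP/negPn/negP => nz; apply: h; eexists; split; [exists b|exact: nz].
have p0 : p != 0.
  apply: contraNneq v0 => p0; apply/eqP/rowP => k; rewrite mxE.
  have := congr1 (fun q : {poly F} => q`_(2 ^ k)) p0; rewrite /= /p.
  rewrite coef0 coef_sum (bigD1 k) //= coefZ coefXn eqxx mulr1 big1 ?addr0 // => j jk.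
  by rewrite coefZ coefXn eqn_exp2l // eq_sym (negPf jk : (_ == _ :> nat) = _) mulr0.
have urs : uniq rs by rewrite map_inj_uniq ?enum_uniq.
have := max_poly_roots p0 prs urs.
rewrite size_map -cardE card_ffun card_bool card_ord ltnNge => /negP; apply.
have d_gt0 : (0 < d)%N.
  case: (posnP d) => // d0; case/eqP: v0; apply/rowP => k.
  by have := ltn_ord k; rewrite [X in (_ < X)%N]d0.
apply: (leq_trans (size_sum _ _ _)); apply/bigmax_leqP => k _.
apply: leq_trans (size_scale_leq _ _) _.
by rewrite size_polyXn ltn_exp2l.
Qed.

(** The Frobenius conjugates diagonalize multiplication by x: the column of the
e_i^(2^k) is an eigenvector of A for the eigenvalue x^(2^k), since the entries of A are
fixed by Frobenius. These columns are independent by [linearized_nonzero]. *)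
Lemma tr_mul_frob (phi : {rmorphism 'Z_4 -> F}) (A : 'M['Z_4]_d) (x : F) :
    (forall i, x * e i = \sum_j e j *+ A i j) ->
  phi (\tr A) = \sum_(k < d) x ^+ (2 ^ k).
Proof.
move=> xA.
have phiE c : phi c = (c : nat)%:R by rewrite -[in LHS](natr_Zp c) rmorph_nat.
pose E : 'M[F]_d := \matrix_(i, k) e i ^+ (2 ^ k).
pose D : 'M[F]_d := diag_mx (\row_k x ^+ (2 ^ k)).
have AE : map_mx phi A *m E = E *m D.
  apply/matrixP => i k; rewrite mul_mx_diag !mxE mulrC -exprMn xA frob_sum.
  apply: eq_bigr => j _; rewrite !mxE phiE -[_ *+ A i j]mulr_natr exprMn frob_nat.
  by rewrite mulrC.
have E0 : \det E != 0.
  rewrite -det_tr; apply/det0P => -[v v0 vE].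
  have [y [[b ->] /eqP]] := linearized_nonzero v0; apply.
  under eq_bigr => k _ do rewrite frob_sum mulr_sumr.
  rewrite exchange_big big1 // => i _ /=.
  have := congr1 (fun u : 'rV_d => u 0 i *+ b i) vE.
  rewrite !mxE mul0rn -sumrMnl => {2}<-; apply: eq_bigr => k _.
  rewrite !mxE -[e i *+ _]mulr_natr exprMn frob_nat mulrA.
  by rewrite mulr_natr.
rewrite -trace_map_mx -[RHS](_ : \tr D = _); last first.
  by rewrite mxtrace_diag; apply: eq_bigr => k _; rewrite mxE.
apply: (mulIf E0); rewrite -!(mulrC (\det E)) -!mxtraceZ -!mul_scalar_mx.
rewrite -[in RHS]mul_adj_mx -mulmxA -AE [RHS]mxtrace_mulC -mulmxA mul_mx_adj.
exact: mxtrace_mulC.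
Qed.

Lemma tr_mul_neq0 : (0 < d)%N -> exists x : F, \sum_(k < d) x ^+ (2 ^ k) != 0.
Proof.
move=> d0; have [|y [_ yn0]] := @linearized_nonzero (const_mx 1).
  apply/eqP => /rowP /(_ (Ordinal d0)); rewrite !mxE => /eqP.
  by rewrite oner_eq0.
by exists y; move: yn0; under eq_bigr => k _ do rewrite mxE mul1r.
Qed.
End FrobeniusTrace.

Section ResidueField.
Variable R : comNzRingType.
Hypothesis R4 : 4%:R = 0 :> R.
Hypothesis Rloc : forall x : R, x \in @twice R \/ (exists y, y * x = 1).

Lemma twice_proper : 1 \notin @twice R.
Proof. by apply: (@unit_ntwice _ R4 _ 1); rewrite mulr1. Qed.

(** The quotient by the ideal of even elements is a field, because everything outside
that ideal is a unit. *)
Lemma residue_field : exists (F : fieldType) (pi : {rmorphism R -> F}),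
  (forall x, (pi x == 0) = (x \in @twice R)) /\ (forall y, exists x, y = pi x).
Proof.
pose I : idealr R := HB.pack (@twice R) (isProperIdeal.Build R (@twice R)
  (conj twice_proper (fun a u => @twiceM R u a))).
pose F0 := {ideal_quot I}.
pose pi0 : {rmorphism R -> F0} := \pi_F0%qT.
have pi0E x : (pi0 x == 0) = (x \in @twice R).
  by rewrite -(rmorph0 pi0) -Quotient.idealrBE subr0.
pose inv (y : F0) : F0 := xget 0 [set z | z * y = 1]%classic.
have inv0 : inv 0 = 0.
  apply: xgetPN => z /=; rewrite mulr0 => /eqP.
  by rewrite eq_sym oner_eq0.
have mulVf y : y != 0 -> inv y * y = 1.
  rewrite -(reprK y) -/(pi0 _) pi0E => yn0.
  have [/(negP yn0)//|[z zy]] := Rloc (repr y).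
  apply: (@xgetPex _ 0 [set z | z * _ = 1]%classic); exists (pi0 z).
  by rewrite /= -rmorphM zy rmorph1.
pose F : fieldType := HB.pack F0 (GRing.ComNzRing_isField.Build F0 mulVf inv0).
exists F, pi0; split => // y; exists (repr y); exact/esym/reprK.
Qed.
End ResidueField.

(** * The trace over the integers modulo four *)

(** An equality of structures, and not merely an isomorphism, so that all the data over R
can be transported by substitution. Opening R into its mixins makes the equality hold
by computation. *)
Lemma finComNzRing_of_cancel (R : comNzRingType) (I : finType) (f : I -> R)
    (g : R -> I) :
  cancel g f -> exists R' : finComNzRingType, R' = R :> comNzRingType.
Proof.
case: R f g => T [m1 m2 m3 m4 m5 m6 m7 m8 m9 m10 m11 m12] f g gK.
set R := GRing.ComNzRing.Pack _ in f g gK *.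
pose cnt := Choice_isCountable.Build R (pcan_pickleK (can_pcan gK)).
pose Rc : countType := HB.pack R cnt.
pose fin := @CanIsFinite Rc _ g f gK.
pose R' : finComNzRingType := HB.pack R cnt fin.
by exists R'.
Qed.

Section Trace4.
Variables (R : comNzRingType) (zeta : {rmorphism 'Z_4 -> R}).
Hypothesis zetaE : forall c, zeta c = (c : nat)%:R.

Lemma sum4E d k (e : 'I_d -> R) (P : 'M['Z_4]_(k, d)) i :
  \sum_j e j *+ P i j = (map_mx zeta P *m \col_j e j) i 0.
Proof.
by rewrite !mxE; apply: eq_bigr => j _; rewrite !mxE zetaE mulr_natl.
Qed.

Lemma basis4_coords d (e : 'I_d -> R) k (u : 'cV[R]_k) : is_basis4 e ->
  exists P : 'M['Z_4]_(k, d), u = map_mx zeta P *m \col_j e j.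
Proof.
move=> he; pose c i := projT1 (cid (he (u i 0))).
exists (\matrix_(i, j) c i j); apply/colP => i; rewrite -sum4E.
rewrite {1}(projT2 (cid (he (u i 0)))).1.
by apply: eq_bigr => j _; rewrite !mxE.
Qed.

Lemma basis4_inj d (e : 'I_d -> R) k (P Q : 'M['Z_4]_(k, d)) : is_basis4 e ->
  map_mx zeta P *m \col_j e j = map_mx zeta Q *m \col_j e j -> P = Q.
Proof.
move=> he PQ; apply/matrixP => i j.
have [c [_ cu]] := he (\sum_j e j *+ P i j).
have cE (S : 'M['Z_4]_(k, d)) : \sum_j e j *+ P i j = \sum_j e j *+ S i j -> 
    c = [ffun j => S i j : 'Z_4].
  by move=> h; apply: cu; rewrite h; apply: eq_bigr => l _; rewrite ffunE.
have := cE P erefl; rewrite (cE Q) ?sum4E ?PQ // => /ffunP /(_ j).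
by rewrite !ffunE.
Qed.

Definition mul_mx4 d (e : 'I_d -> R) (x : R) (A : 'M['Z_4]_d) :=
  x *: (\col_j e j) = map_mx zeta A *m \col_j e j.

Lemma mul_mx4P d (e : 'I_d -> R) (x : R) (A : 'M['Z_4]_d) :
  (forall i, x * e i = \sum_j e j *+ A i j) <-> mul_mx4 e x A.
Proof.
split=> [h|h i]; first by apply/colP => i; rewrite -sum4E -h !mxE.
by rewrite sum4E -h !mxE.
Qed.

(** The trace does not depend on the basis, even if the two bases are not known to have
the same size: the transition matrices P and Q are inverse to each other and intertwine
A and A'. *)
Lemma tr_mul_mx4 d d' (e : 'I_d -> R) (e' : 'I_d' -> R) x A A' :
  is_basis4 e -> is_basis4 e' -> mul_mx4 e x A -> mul_mx4 e' x A' ->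
  \tr A = \tr A'.
Proof.
move=> he he' hA hA'.
have [P eP] := basis4_coords (\col_j e' j) he.
have [Q eQ] := basis4_coords (\col_j e j) he'.
have QP : Q *m P = 1%:M.
  by apply: (basis4_inj he); rewrite map_mxM -mulmxA -eP -eQ map_mx1 mul1mx.
have PA : P *m A = A' *m P.
  apply: (basis4_inj he); rewrite !map_mxM -!mulmxA -hA -eP -hA'.
  by rewrite -scalemxAr -eP.
have PQ : P *m Q = 1%:M.
  by apply: (basis4_inj he'); rewrite map_mxM -mulmxA -eQ -eP map_mx1 mul1mx.
by rewrite -[A']mulmx1 -PQ mulmxA -PA mxtrace_mulC mulmxA QP mul1mx.
Qed.

Variables (d : nat) (e : 'I_d -> R).
Hypothesis he : is_basis4 e.

Lemma trace4E x A : mul_mx4 e x A -> trace4 x = \tr A.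
Proof.
move=> hA; rewrite /trace4.
have : is_trace4 x (xget 0 (is_trace4 x)).
  by apply: xgetPex; exists (\tr A), d, e, A; split=> //; apply/mul_mx4P.
by case=> d' [e' [A' [he' /mul_mx4P hA' ->]]]; exact: esym (tr_mul_mx4 he he' hA hA').
Qed.

Lemma mul_mx4_ex x : exists A, mul_mx4 e x A.
Proof. exact: basis4_coords. Qed.

Lemma trace4D (x y : R) : trace4 (x + y) = trace4 x + trace4 y.
Proof.
have [[A hA] [B hB]] := (mul_mx4_ex x, mul_mx4_ex y).
rewrite (trace4E hA) (trace4E hB) -mxtraceD; apply: trace4E.
by rewrite /mul_mx4 scalerDl hA hB -mulmxDl map_mxD.
Qed.

Lemma trace4N (x : R) : trace4 (- x) = - trace4 x.
Proof.
have [A hA] := mul_mx4_ex x; rewrite (trace4E hA) -linearN; apply: trace4E.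
by rewrite /mul_mx4 scaleNr hA -mulNmx map_mxN.
Qed.

Lemma basis4_finite : exists R' : finComNzRingType, R' = R :> comNzRingType.
Proof.
pose f (c : {ffun 'I_d -> 'Z_4}) := \sum_i e i *+ c i.
pose g x := projT1 (cid (he x)).
have gK : cancel g f by move=> x; apply/esym; exact: (projT2 (cid (he x))).1.
exact: finComNzRing_of_cancel gK.
Qed.

Hypothesis Rloc : forall x : R, x \in @twice R \/ (exists y, y * x = 1).

Lemma char4_of_Z4 : 4%:R = 0 :> R.
Proof.
rewrite -(rmorph_nat zeta) (_ : 4%:R = 0) ?rmorph0 //; exact: val_inj.
Qed.

(** A Z/4-basis stays linearly independent modulo 2: if two 0-1 combinations differ by an
even element, comparing coordinates in Z/4 makes their coefficients congruent
modulo 2. *)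
Lemma basis4_free (F : fieldType) (pi : {rmorphism R -> F}) :
    (forall x, (pi x == 0) = (x \in @twice R)) ->
  injective (fun b : {ffun 'I_d -> bool} => \sum_i pi (e i) *+ b i).
Proof.
move=> piE b b' eb.
have : \sum_i e i *+ b i - \sum_i e i *+ b' i \in @twice R.
  have piS (a : {ffun 'I_d -> bool}) : pi (\sum_i e i *+ a i) = \sum_i pi (e i) *+ a i.
    by rewrite rmorph_sum; apply: eq_bigr => i _; rewrite rmorphMn.
  by rewrite -piE rmorphB /= !piS eb subrr.
case/twiceP => y.
have [C /(congr1 (fun u : 'cV_1 => u 0 0))] := basis4_coords (const_mx y : 'cV_1) he.
rewrite mxE => -> /eqP; rewrite subr_eq => /eqP.
pose rv (a : {ffun 'I_d -> bool}) : 'rV['Z_4]_d := \row_i (a i : nat)%:R.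
have rvE (a : {ffun 'I_d -> bool}) :
    \sum_i e i *+ a i = (map_mx zeta (rv a) *m \col_j e j) 0 0.
  by rewrite -sum4E; apply: eq_bigr => i _; rewrite mxE; case: (a i).
rewrite !rvE => bb.
have /rowP bC : rv b = C *+ 2 + rv b'.
  apply: (basis4_inj he); apply/matrixP => i j; rewrite !ord1 bb.
  by rewrite map_mxD mulmxDl mulr2n map_mxD mulmxDl [RHS]mxE [X in _ = X + _]mxE.
apply/ffunP => i; have := congr1 (fun a => a *+ 2) (bC i).
have z4 (a : 'Z_4) : a *+ 2 *+ 2 = 0.
  by rewrite -mulrnA -mulr_natr (_ : (2 * 2)%:R = 0) ?mulr0 //; apply: val_inj.
by rewrite !mxE -mulr2n mulrnDl z4 add0r; case: (b i); case: (b' i).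
Qed.

Lemma basis4_gt0 : (0 < d)%N.
Proof.
case: (posnP d) => // d0; have [c [e1 _]] := he 1.
have /eqP[] : (1 : R) != 0 by apply: oner_neq0.
by rewrite e1 big1 // => i _; have := ltn_ord i; rewrite [X in (_ < X)%N]d0.
Qed.

(** Both facts are read off from the sum of Frobenius powers in the residue field: squaring
x applies Frobenius to the sum, which lies in the prime field, and the sum is not
identically zero. *)
Lemma trace4_mod2 : 
  (forall x : R, trace4 (x ^+ 2) *+ 2 = trace4 x *+ 2) /\
  exists x : R, trace4 x *+ 2 != 0.
Proof.
have [F [pi [piE pi_surj]]] := residue_field char4_of_Z4 Rloc.
have F2 : 2%N \in [pchar F].
  rewrite inE /= -(rmorph_nat pi) piE; apply/twiceP; by exists 1.
pose phi : {rmorphism 'Z_4 -> F} := pi \o zeta.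
have phiE (a : 'Z_4) : phi a = (odd a)%:R.
  by rewrite -natr_bool // /phi /= zetaE rmorph_nat.
have phi_inj c c' : phi c = phi c' -> c *+ 2 = c' *+ 2.
  rewrite !phiE => h.
  have : odd c = odd c'.
    move: h; case: (odd c); case: (odd c') => //.
      by move/eqP; rewrite oner_eq0.
    by move/eqP; rewrite eq_sym oner_eq0.
  case: c {h} => [[|[|[|[|]]]] hc] //; case: c' => [[|[|[|[|]]]] hc'] // _; exact: val_inj.
have e_free := basis4_free piE.
have trE x : phi (trace4 x) = \sum_(k < d) pi x ^+ (2 ^ k).
  have [A hA] := mul_mx4_ex x; rewrite (trace4E hA).
  apply: (tr_mul_frob F2 e_free) => i.
  rewrite -rmorphM ((mul_mx4P _ _ _).2 hA) rmorph_sum.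
  by apply: eq_bigr => j _; rewrite rmorphMn.
split=> [x|].
  apply: phi_inj; rewrite trE.
  have -> : phi (trace4 x) = phi (trace4 x) ^+ (2 ^ 1).
    by rewrite /phi /= zetaE rmorph_nat frob_nat.
  rewrite trE frob_sum //; apply: eq_bigr => k _.
  by rewrite rmorphXn -!exprM mulnC.
have [y yn0] := tr_mul_neq0 e_free basis4_gt0.
have [x yx] := pi_surj y; exists x.
apply: contraNneq yn0 => tx; rewrite yx -trE phiE.
by case: (trace4 x) tx => [[|[|[|[|]]]] hc].
Qed.
End Trace4.

(** * Gauss sums over W/2W *)

Section GaussBridge.
Variable T : realType.

(** The condition for B(w,w) to depend only on the class of w in W/2W. *)
Definition form_mod2 (W : zmodType) (B : W -> W -> 'Z_4) :=
  forall v u, B (v + u *+ 2) (v + u *+ 2) = B v v.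

Definition mod2 (W : zmodType) (x : W) : Quotient.quot (@twice W) :=
  (\pi_(Quotient.quot (@twice W)) x)%qT.

Lemma mod2K (W : zmodType) (w : Quotient.quot (@twice W)) : mod2 (repr w) = w.
Proof. exact: reprK. Qed.

Lemma mod2E (W : zmodType) (x y : W) : (mod2 x == mod2 y) = (x - y \in @twice W).
Proof. by rewrite -Quotient.idealrBE. Qed.

Lemma form_repr (W : zmodType) (B : W -> W -> 'Z_4) (x : W)
    (w := repr (mod2 x)) :
  form_mod2 B -> B w w = B x x.
Proof.
move=> hB; have : w - x \in @twice W by rewrite -mod2E /w mod2K.
by case/twiceP => u e; rewrite -[w](subrK x) e addrC hB.
Qed.

Lemma gauss_iso (W W' : zmodType) (f : W' -> W) (B : W -> W -> 'Z_4) :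
    zmod_morphism f -> bijective f -> form_mod2 (fun x y => B (f x) (f y)) ->
  gauss T B = gauss T (fun x y => B (f x) (f y)).
Proof.
move=> fB [g fK gK] hBf.
have gB : zmod_morphism g.
  by move=> x y; apply: (can_inj fK); rewrite gK fB !gK.
pose fA : {additive W' -> W} := HB.pack f (GRing.isZmodMorphism.Build W' W f fB).
pose gA : {additive W -> W'} := HB.pack g (GRing.isZmodMorphism.Build W W' g gB).
have hB : form_mod2 B.
  move=> v u; rewrite -(gK v) -(gK u) -(raddfMn fA) -(raddfD fA).
  exact: hBf.
pose h (w : Quotient.quot (@twice W')) : Quotient.quot (@twice W) :=
  mod2 (f (repr w)).
pose k (w : Quotient.quot (@twice W)) : Quotient.quot (@twice W') :=
  mod2 (g (repr w)).
have hE x : h (mod2 x) = mod2 (f x).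
  apply/eqP; rewrite mod2E -fB; set y := repr _.
  have : y - x \in @twice W' by rewrite -mod2E /y mod2K.
  by case/twiceP => u ->; apply/twiceP; exists (f u); exact: (raddfMn fA).
have kE x : k (mod2 x) = mod2 (g x).
  apply/eqP; rewrite mod2E -gB; set y := repr _.
  have : y - x \in @twice W by rewrite -mod2E /y mod2K.
  by case/twiceP => u ->; apply/twiceP; exists (g u); exact: (raddfMn gA).
rewrite /gauss (reindex_fsbigT h); last first.
  exists k => w; first by rewrite -[w]mod2K hE kE fK.
  by rewrite -[w]mod2K kE hE gK.
by apply: eq_fsbigr => w _; rewrite /h form_repr.
Qed.

Lemma gauss_orthosum_iso k (W W' : zmodType) (f : W' -> W)
    (B : W -> W -> 'Z_4) (B' := fun x y => B (f x) (f y)) :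
    zmod_morphism f -> bijective f -> form_mod2 (orthosum (m := k) B') ->
  gauss T (orthosum (m := k) B) = gauss T (orthosum (m := k) B').
Proof.
move=> fB [g fK gK] hB'.
pose F (v : {ffun 'I_k -> W'}) : {ffun 'I_k -> W} := [ffun i => f (v i)].
have FB : (fun v w => orthosum B (F v) (F w)) = orthosum B'.
  apply/funext => v; apply/funext => w.
  by apply: eq_bigr => i _; rewrite !ffunE.
rewrite (@gauss_iso _ _ F) ?FB //.
  by move=> v w; apply/ffunP => i; rewrite !ffunE fB.
by exists (fun v : {ffun 'I_k -> W} => [ffun i => g (v i)] : {ffun 'I_k -> W'})
  => v; apply/ffunP => i; rewrite !ffunE.
Qed.

(** A sum over a finite W is the sum over W/2W repeated once for each element of 2W,
as all the cosets of 2W have the same size. *)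
Lemma gauss_finite (W : zmodType) (F : finType) (f : F -> W)
    (B : W -> W -> 'Z_4) :
    bijective f -> form_mod2 B ->
  #|[pred v | f v \in @twice W]|%:R * gauss T B =
  \sum_(v : F) expi4 T (B (f v) (f v)).
Proof.
move=> [g fK gK] hB; set K := #|_|.
pose Q := Quotient.quot (@twice W).
pose p (v : F) : Q := mod2 (f v).
pose h (w : Q) := expi4 T (B (repr w) (repr w)).
have hp v : h (p v) = expi4 T (B (f v) (f v)) by rewrite /h form_repr.
pose rs := undup [seq p v | v : F].
have p_rs w : w \in rs.
  rewrite mem_undup; apply/mapP; exists (g (repr w)); first exact: mem_enum.
  by rewrite /p gK mod2K.
have -> : gauss T B = \sum_(w <- rs) h w.
  rewrite fsbig_seq ?undup_uniq //; apply: eq_fsbigl.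
  by apply/seteqP; split => w //= _; exact: p_rs.
have fib w : #|[pred v | p v == w]| = K.
  rewrite /K -!sum1_card (reindex (fun v => g (f v + repr w))).
    apply: eq_bigl => v; rewrite !inE /p gK -{2}[w]mod2K mod2E.
    by rewrite addrK.
  exists (fun v => g (f v - repr w)) => v _; rewrite gK ?addrK ?subrK fK //.
under [RHS]eq_bigr => v _ do rewrite -hp.
rewrite mulr_sumr (eq_bigr (fun w => \sum_(v | p v == w) h (p v))) => [|w _].
  rewrite (exchange_big_dep xpredT) //=; apply: eq_bigr => v _.
  rewrite big_mkcond (bigD1_seq (p v)) ?undup_uniq ?p_rs //= eqxx big1 ?addr0 //.
  by move=> w wv; rewrite eq_sym (negPf wv).
rewrite (eq_bigr (fun=> h w)) => [|v /eqP -> //].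
by rewrite sumr_const fib mulr_natl.
Qed.

Lemma expi4D (a b : 'Z_4) : expi4 T (a + b) = expi4 T a * expi4 T b.
Proof.
pose E (k : nat) : T[i] := let t := 2 * pi / 4 * k%:R in (cos t +i* sin t)%C.
have ED k l : E (k + l)%N = E k * E l.
  rewrite /E /= natrD mulrDr cosD sinD; congr (_ +i* _)%C.
  by rewrite addrC [sin _ * cos _]mulrC.
have E4 : E 4 = 1.
  rewrite /E /= -mulrA mulVf ?pnatr_eq0 // mulr1 mulr_natl.
  by rewrite cos2pi sin2pi.
have Emod k : E (k %% 4)%N = E k.
  rewrite [in RHS](divn_eq k 4) ED; elim: (k %/ 4)%N => [|q IHq].
    by rewrite /E /= mulr0 cos0 sin0 mul1r.
  by rewrite mulSn ED E4 mul1r.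
by rewrite -[LHS]/(E ((a + b)%N %% 4)%N) Emod ED.
Qed.

Lemma expi40 : expi4 T 0 = 1.
Proof. by rewrite /expi4 /= mulr0 cos0 sin0. Qed.

Lemma expi4_double c : c *+ 2 != 0 -> expi4 T (c *+ 2) != 1.
Proof.
move=> c2; have -> : c *+ 2 = 2%:R.
  by case: c c2 => [[|[|[|[|]]]] hc] // _; apply: val_inj.
have -> : expi4 T 2%:R = (cos (2 * pi / 4 * 2) +i* sin (2 * pi / 4 * 2))%C by [].
have -> : 2 * pi / 4 * 2 = pi :> T by field.
by rewrite cospi sinpi eq_complex /= eqxx andbT eqNr oner_eq0.
Qed.
End GaussBridge.

(** * The pairing of exterior powers *)

Section WedgePairing.
Variables (R : comNzRingType) (n : nat).

Lemma ext_liftZ (M W : lmodType R) (f : {ffun 'I_n -> M} -> W) (a : R)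
    (x : extpow M n) :
  @Defs.multilinear R M n W f -> @Defs.alternating R M n W f ->
  ext_lift f (a *: x) = a *: ext_lift f x.
Proof.
move=> fl fa; have := ext_lift_linear a x 0 fl fa; rewrite addr0 => ->.
have := ext_lift_linear (-1) 0 0 fl fa; rewrite scaler0 addr0 scaleN1r addNr => ->.
by rewrite addr0.
Qed.

Lemma ext_lift_comb (M W : lmodType R) (a : R) (f g h : {ffun 'I_n -> M} -> W)
    (w : extpow M n) :
  (forall m, h m = a *: f m + g m) ->
  ext_lift h w = a *: ext_lift f w + ext_lift g w.
Proof.
move=> hE; rewrite /ext_lift; unlock fglift; rewrite /freeg.lift /prelift scaler_sumr.
rewrite -big_split; apply: eq_bigr => z _ /=.
by rewrite hE scalerDr !scalerA mulrC.
Qed.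

Variables (V : lmodType R) (omega : {biscalar V}) (L M : submodClosed V).

(** The pairing is defined by lifting a multilinear map twice; linearity of the outer
lift requires that the inner lift, as a function of l, is again multilinear and
alternating. *)
Lemma omega_wedgeZ a b (x : extpow (submod L) n) (y : extpow (submod M) n) :
  omega_wedge omega (a *: x) (b *: y) = a * b * omega_wedge omega x y.
Proof.
rewrite /omega_wedge.
pose g (l : {ffun 'I_n -> submod L}) (m : {ffun 'I_n -> submod M}) : R^o :=
  \det (\matrix_(i, j) omega (val (l i)) (val (m j))).
have inner l z : ext_lift (g l) (b *: z) = b *: ext_lift (g l) z.
  apply: ext_liftZ; [exact: pairing_det_multilinearr|exact: pairing_det_alternatingr].
have zero (z : extpow (submod L) n) : ext_lift (fun=> 0 : R^o) z = 0.
  by rewrite (@ext_lift_comb _ R^o (-1) (fun=> 0) (fun=> 0)) => [|m]; rewrite scaleN1r addNr.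
have zero' (z : extpow (submod M) n) : ext_lift (fun=> 0 : R^o) z = 0.
  by rewrite (@ext_lift_comb _ R^o (-1) (fun=> 0) (fun=> 0)) => [|m]; rewrite scaleN1r addNr.
rewrite ext_liftZ.
- rewrite (@ext_lift_comb _ R^o b (fun l => ext_lift (g l) y) (fun=> 0)) => [|l].
    by rewrite zero addr0 scalerA.
  by rewrite addr0 -inner.
- move=> l i c u v; apply: ext_lift_comb => m.
  exact: pairing_det_multilinearl.
- move=> l i j nij lij; rewrite -[RHS](zero' (b *: y)); congr (ext_lift _ _).
  apply/funext => m; exact: pairing_det_alternatingl nij lij.
Qed.
End WedgePairing.

(** * Transverse Lagrangians *)

Lemma submodB (R : comNzRingType) (V : lmodType R) (L : submodClosed V) u v :
  u \in L -> v \in L -> u - v \in L.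
Proof. by move=> uL vL; rewrite -scaleN1r rpredD // rpredZ. Qed.

Definition comb (R : comNzRingType) (M : lmodType R) n (e : 'I_n -> M)
    (c : 'rV[R]_n) : M := \sum_i c 0 i *: e i.

Lemma combP (R : comNzRingType) (M : lmodType R) n (e : 'I_n -> M) a c c' :
  comb e (a *: c + c') = a *: comb e c + comb e c'.
Proof.
rewrite /comb scaler_sumr -big_split; apply: eq_bigr => i _.
by rewrite !mxE scalerDl scalerA.
Qed.

Lemma comb_bij (R : comNzRingType) (M : lmodType R) n (e : 'I_n -> M) :
  is_basis e -> bijective (comb e).
Proof.
move=> be; pose g x : 'rV[R]_n := \row_i projT1 (cid (be x)) i.
have gK : cancel g (comb e).
  move=> x; rewrite [RHS](projT2 (cid (be x))).1.
  by apply: eq_bigr => i _; rewrite mxE.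
exists g => // c; apply/rowP => i; rewrite mxE.
rewrite ((projT2 (cid (be (comb e c)))).2 [ffun i => c 0 i]) ?ffunE //.
by apply: eq_bigr => j _; rewrite ffunE.
Qed.

Lemma val_comb (R : comNzRingType) (V : lmodType R) (L : submodClosed V) n
    (e : 'I_n -> submod L) (c : 'rV[R]_n) :
  val (comb e c) = \sum_i c 0 i *: val (e i).
Proof. exact: raddf_sum. Qed.

Section TransverseLagrangians.
Variables (R : comNzRingType) (V : lmodType R) (omega : {biscalar V}).
Hypothesis homega : symplectic omega.

Lemma omega_skew u v : omega u v = - omega v u.
Proof.
have /eqP := homega.1 (u + v).
rewrite linearDl !linearDr /= !homega.1 add0r addr0 addr_eq0 => /eqP //.
Qed.

Lemma omega_nondeg v : (forall w, omega v w = 0) -> v = 0.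
Proof.
move=> hv; have [u [_ uu]] := homega.2 \0.
by rewrite -(uu v) // (uu 0) // => w; rewrite linear0l.
Qed.

(** A common vector of two transverse Lagrangians is orthogonal to both, hence to the
whole space. *)
Lemma transverse_cap (M L : submodClosed V) v :
    lagrangian omega M -> lagrangian omega L -> general_position M L ->
  v \in M -> v \in L -> v = 0.
Proof.
move=> lM lL gp vM vL; apply: omega_nondeg => w.
have [m [l [mM lL' ->]]] := gp w.
by rewrite linearDr /= (proj1 (lM v) vM) // (proj1 (lL v) vL) // addr0.
Qed.

Definition gram (L M : submodClosed V) n (l : 'I_n -> submod L)
    (m : 'I_n -> submod M) : 'M[R]_n :=
  \matrix_(i, j) omega (val (l i)) (val (m j)).

Lemma tr_gram (L M : submodClosed V) n (l : 'I_n -> submod L)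
    (m : 'I_n -> submod M) : (gram l m)^T = - gram m l.
Proof. by apply/matrixP => i j; rewrite !mxE omega_skew. Qed.

(** The pairing of transverse Lagrangians is perfect: a coordinate on M, extended by 0
along L, is represented by a vector v, and v lies in L since it is orthogonal to L. The
coordinates of these vectors form an inverse of the matrix of the pairing. *)
Lemma gram_unit (M L : submodClosed V) n (m : 'I_n -> submod M)
    (l : 'I_n -> submod L) :
    lagrangian omega M -> lagrangian omega L -> general_position M L ->
    is_basis m -> is_basis l ->
  exists y, y * \det (gram l m) = 1.
Proof.
move=> lM lL gp bm bl.
have dec v : exists c : 'rV[R]_n, v - val (comb m c) \in L.
  have [a [b [aM bL ->]]] := gp v; have [g _ gK] := comb_bij bm.
  by exists (g (Sub a aM)); rewrite gK SubK addrAC subrr add0r.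
pose cf v := projT1 (cid (dec v)).
have cfP v : v - val (comb m (cf v)) \in L by exact: projT2 (cid (dec v)).
have cfU v (c : 'rV[R]_n) : v - val (comb m c) \in L -> c = cf v.
  move=> hc; apply: (bij_inj (comb_bij bm)).
  apply/eqP; rewrite -subr_eq0; apply/eqP/val_inj; rewrite raddf0.
  apply: (transverse_cap lM lL gp); first exact: valP.
  have := submodB (cfP v) hc; rewrite [val (_ - _)]raddfB /=.
  by rewrite opprB addrC addrA subrK.
have cf_lin a u v : cf (a *: u + v) = a *: cf u + cf v.
  apply/esym/cfU; rewrite combP [val _]linearP /= opprD addrACA -scalerBr.
  by apply: rpredD (cfP v); apply: rpredZ.
have dual j : exists c : 'rV[R]_n,
    forall k, omega (val (comb l c)) (val (m k)) = (j == k)%:R.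
  pose f0 (v : V) : R^o := cf v 0 j.
  have f0l : linear f0 by move=> a u v; rewrite /f0 cf_lin !mxE.
  pose f : {scalar V} := HB.pack f0 (GRing.isLinear.Build R V R^o _ f0 f0l).
  have [v [vf _]] := homega.2 f.
  have vL : v \in L.
    apply/lL => w wL; rewrite vf /= /f0 -(cfU w 0) ?mxE //.
    by rewrite /comb big1 ?raddf0 ?addr0 // => i _; rewrite mxE scale0r.
  have [g _ gK] := comb_bij bl; exists (g (Sub v vL)) => k.
  rewrite gK SubK vf /= /f0 -(cfU _ (delta_mx 0 k)) ?mxE //.
  rewrite /comb (bigD1 k) //= big1 => [|i ik].
    by rewrite addr0 mxE !eqxx scale1r subrr rpred0.
  by rewrite mxE (negPf ik) andbF scale0r.
pose X := \matrix_(j, i) projT1 (cid (dual j)) 0 i.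
have XG : X *m gram l m = 1%:M.
  apply/matrixP => j k; rewrite !mxE -(projT2 (cid (dual j)) k) val_comb.
  rewrite linear_sumlz; apply: eq_bigr => i _.
  by rewrite !mxE linearZl_LR.
by exists (\det X); rewrite -det_mulmx XG det1.
Qed.

Lemma alongP (N L : submodClosed V) v :
  general_position N L -> val (along N L v) - v \in L.
Proof.
move=> gp; have [x [l [xN lL ->]]] := gp v.
apply: (@xgetPex _ 0 [set y : submod N | val y - (x + l) \in L]%classic).
by exists (Sub x xN); rewrite /= opprD addNKr -scaleN1r rpredZ.
Qed.

Section Triple.
Variables (N M L : submodClosed V).
Hypotheses (lN : lagrangian omega N) (lM : lagrangian omega M)
  (lL : lagrangian omega L) (gNL : general_position N L).

(** Expand omega(r m1 - m1, r m2 - m2), which vanishes because L is isotropic; two of the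
four terms vanish because N and M are. *)
Lemma omega_along_sym (m1 m2 : submod M) :
  omega_along omega N L m1 m2 = omega_along omega N L m2 m1.
Proof.
rewrite /omega_along; set r1 := val (along N L (val m1)).
set r2 := val (along N L (val m2)).
have h : omega (r1 - val m1) (r2 - val m2) = 0.
  by apply: (proj1 (lL _)); apply: alongP.
have h1 : omega r1 r2 = 0 by apply: (proj1 (lN _)); apply: valP.
have h2 : omega (val m1) (val m2) = 0 by apply: (proj1 (lM _)); apply: valP.
move/eqP: h; rewrite linearBl !linearBr /= h1 h2 sub0r subr0.
by rewrite (omega_skew (val m1) r2) opprK addrC subr_eq0 => /eqP.
Qed.

Variables (n : nat) (e : 'I_n -> submod N) (m : 'I_n -> submod M)
  (l : 'I_n -> submod L).

(** The matrix of -omega_L. The sign is chosen so that its determinant involves no sign: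
see [det_maslov]. *)
Definition maslov_mx : 'M[R]_n :=
  \matrix_(i, j) - omega_along omega N L (m i) (m j).

Lemma tr_maslov : maslov_mx^T = maslov_mx.
Proof. by apply/matrixP => i j; rewrite !mxE omega_along_sym. Qed.

Lemma along_comb x :
  along N L (val (comb m x)) = \sum_i x 0 i *: along N L (val (m i)).
Proof.
apply: val_inj; apply/eqP; rewrite -subr_eq0; apply/eqP.
apply: (transverse_cap lN lL gNL); first by rewrite -raddfB; apply: valP.
have h1 := alongP (val (comb m x)) gNL.
have h2 : val (\sum_i x 0 i *: along N L (val (m i))) - val (comb m x) \in L.
  rewrite val_comb raddf_sum -sumrB; apply: rpred_sum => i _ /=.
  rewrite -scalerBr rpredZ //; exact: alongP.
by have := submodB h1 h2; rewrite opprB addrA subrK.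
Qed.

Lemma maslov_mxE x y :
  - omega_along omega N L (comb m x) (comb m y) = (x *m maslov_mx *m y^T) 0 0.
Proof.
rewrite /omega_along along_comb raddf_sum linear_sumlz -mulmxA mxE -sumrN.
apply: eq_bigr => i _; rewrite linearZl_LR val_comb linear_sumr mxE -mulrN.
congr (_ * _); rewrite -sumrN.
by apply: eq_bigr => j _; rewrite !mxE linearZ /= mulrC mulNr.
Qed.

(** With rho the matrix of r^L : M -> N, the matrix of omega_L is rho (e,m), and r^L(m) - m
in L means rho (e,l) = (m,l). Transposing each pairing costs a sign, and the sign of
-omega_L absorbs it. *)
Lemma det_maslov : is_basis e ->
  \det maslov_mx * \det (gram l e) = \det (gram l m) * \det (gram m e).
Proof.
move=> be; have [g _ gK] := comb_bij be.
pose rho : 'M[R]_n := \matrix_i g (along N L (val (m i))).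
have rhoE i k K (f : 'I_n -> submod K) :
    omega (val (along N L (val (m i)))) (val (f k)) = (rho *m gram e f) i k.
  rewrite -[along _ _ _]gK val_comb linear_sumlz mxE; apply: eq_bigr => j _.
  by rewrite linearZl_LR !mxE.
have -> : maslov_mx = rho *m (gram m e)^T.
  apply/matrixP => i j; by rewrite tr_gram mulmxN [LHS]mxE [RHS]mxE /omega_along rhoE.
have rhoL : rho *m (gram l e)^T = (gram l m)^T.
  apply/matrixP => i j; rewrite !tr_gram mulmxN [LHS]mxE [RHS]mxE -rhoE mxE.
  congr (- _); apply/eqP; rewrite -subr_eq0 -linearBl; apply/eqP.
  by apply: (proj1 (lL _)); [exact: alongP | exact: valP].
by rewrite -[\det (gram l m)]det_tr -rhoL !det_mulmx !det_tr mulrAC.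
Qed.
End Triple.
End TransverseLagrangians.

(** * The cocycle relation *)

Lemma diag_last_bil (R : comNzRingType) n (c : R) (x y : 'rV[R]_n) :
  diag_last c x y = bil (diag_mx (\row_(i < n) if i.+1 == n then c else 1)) x y.
Proof.
rewrite /bil mul_mx_diag mxE; apply: eq_bigr => i _.
by rewrite !mxE [x 0 i * _]mulrC.
Qed.

Lemma det_diag_last (R : comNzRingType) n (c : R) : (0 < n)%N ->
  \det (diag_mx (\row_(i < n) if i.+1 == n then c else 1)) = c.
Proof.
case: n => // n _; rewrite det_diag (bigD1 ord_max) //= mxE eqxx big1 ?mulr1 //.
by move=> i; rewrite mxE eqSS -val_eqE /= => /negPf ->.
Qed.

Lemma trace4_no_basis (R : comNzRingType) :
  ~ (exists d (e : 'I_d -> R), is_basis4 e) -> forall x : R, trace4 x = 0.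
Proof.
move=> nb x; apply: xgetPN => t [d [e [A [he _ _]]]].
by apply: nb; exists d, e.
Qed.

Lemma orthosum_form_mod2 (R : comNzRingType) k n (G : 'M[R]_n) :
    4%:R = 0 :> R -> G^T = G ->
  form_mod2 (orthosum (m := k) (fun x y => trace4 (bil G x y))).
Proof.
move=> R4 Gs v u; apply: eq_bigr => i _; congr trace4.
by rewrite !ffunE; apply: (bil_shift R4).
Qed.

Section DoubledForms.
Variables (T : realType) (R : finComNzRingType).
Hypothesis R4 : 4%:R = 0 :> R.
Hypothesis tD : forall x y : R, trace4 (x + y) = trace4 x + trace4 y.

(** Over two copies of the module the full Gauss sum is the square of the sum over one
copy. *)
Lemma gauss_double n (G : 'M[R]_n) : G^T = G ->
  #|[pred v : {ffun 'I_2 -> 'rV[R]_n} | v \in @twice _]|%:R *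
    gauss T (orthosum (m := 2) (fun x y => trace4 (bil G x y))) =
  gsum (fun a : R => expi4 T (trace4 a)) G ^+ 2.
Proof.
move=> Gs; have idb : bijective (fun v : {ffun 'I_2 -> 'rV[R]_n} => v).
  by exists id.
rewrite (gauss_finite T idb (orthosum_form_mod2 R4 Gs)).
rewrite -[2%N in RHS]card_ord -prodr_const bigA_distr_bigA.
by apply: eq_bigr => v _; exact: (big_morph _ (@expi4D T) (expi40 T)).
Qed.

(** All four Gauss sums have the same rank, so that only the values of chi at the
determinants remain, and chi ignores the square of a. *)
Lemma gauss_relation_finite n (c1 c2 c3 a : R) (G : 'M[R]_n)
    (A := fun c : R => gauss T (orthosum (m := 2) (fun x y : 'rV[R]_n =>
       trace4 (diag_last c x y)))) :
    (forall x : R, x \in @twice R \/ (exists y, y * x = 1)) ->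
    (forall x : R, trace4 (x ^+ 2) *+ 2 = trace4 x *+ 2) ->
    (exists x : R, trace4 x *+ 2 != 0) ->
    (0 < n)%N -> G^T = G ->
    (exists y, y * c1 = 1) -> (exists y, y * c2 = 1) ->
    (exists y, y * c3 = 1) -> (exists y, y * a = 1) ->
    (exists y, y * \det G = 1) ->
    \det G * c3 = a ^+ 2 * (c1 * c2) ->
  A c1 * A c2 =
    gauss T (orthosum (m := 2) (fun x y => trace4 (bil G x y))) * A c3.
Proof.
move=> Rloc tF [x0 tN] n0 Gs [y1 u1] [y2 u2] [y3 u3] [ya ua] [yG uG] eG.
pose psi (x : R) := expi4 T (trace4 x).
have t0 : trace4 (0 : R) = 0.
  by have := tD 0 0; rewrite addr0 -{1}[trace4 0]addr0 => /addrI.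
have psi0 : psi 0 = 1 by rewrite /psi t0 expi40.
have psiD x y : psi (x + y) = psi x * psi y by rewrite /psi tD expi4D.
have psiF x : psi (x ^+ 2 *+ 2) = psi (x *+ 2).
  by rewrite /psi !mulr2n !tD -!mulr2n tF.
have psiN : exists x, psi (x *+ 2) != 1.
  by exists x0; rewrite /psi mulr2n tD -mulr2n expi4_double.
(* The four sums run over modules of the same rank, so one factor normalizes them all. *)
set K : T[i] := #|[pred v : {ffun 'I_2 -> 'rV[R]_n} | v \in @twice _]|%:R.
have K0 : K != 0.
  rewrite pnatr_eq0 -lt0n; apply/card_gt0P; exists 0.
  by apply/twiceP; exists 0; rewrite mul0rn.
have det (H : 'M[R]_n) : H^T = H -> (exists y, y * \det H = 1) ->
    K * gauss T (orthosum (m := 2) (fun x y => trace4 (bil H x y))) =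
    kappa psi ^+ n * chi psi (\det H).
  move=> Hs [y yH]; rewrite gauss_double //.
  exact: (det_law_unimodular R4 Rloc psi0 psiD psiF psiN Hs yH).
have AE c : (exists y, y * c = 1) -> K * A c = kappa psi ^+ n * chi psi c.
  move=> uc; rewrite /A.
  have -> : (fun x y : 'rV[R]_n => trace4 (diag_last c x y)) = (fun x y =>
      trace4 (bil (diag_mx (\row_(i < n) if i.+1 == n then c else 1)) x y)).
    by apply/funext => x; apply/funext => y; rewrite diag_last_bil.
  by rewrite det ?tr_diag_mx ?det_diag_last.
have cM := chiM R4 Rloc psi0 psiD psiF psiN.
have chiE : chi psi c1 * chi psi c2 = chi psi (\det G) * chi psi c3.
  rewrite -(cM _ _ _ _ u1 u2) -(cM _ _ _ _ uG u3) eG.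
  by rewrite (chi_sqr psi _ ua).
have D := det G Gs (ex_intro _ yG uG).
have [A1 A2] := (AE c1 (ex_intro _ y1 u1), AE c2 (ex_intro _ y2 u2)).
have A3 := AE c3 (ex_intro _ y3 u3).
apply: (mulfI (mulf_neq0 K0 K0)).
rewrite [LHS]mulrACA [RHS]mulrACA A1 A2 D A3.
by rewrite [LHS]mulrACA [RHS]mulrACA chiE.
Qed.
End DoubledForms.

Lemma gauss_relation (T : realType) (R : comNzRingType) n
    (c1 c2 c3 a : R) (G : 'M[R]_n)
    (A := fun c : R => gauss T (orthosum (m := 2) (fun x y : 'rV[R]_n =>
       trace4 (diag_last c x y)))) d (e : 'I_d -> R) :
    4%:R = 0 :> R -> is_basis4 e ->
    (forall x : R, x \in @twice R \/ (exists y, y * x = 1)) ->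
    (0 < n)%N -> G^T = G ->
    (exists y, y * c1 = 1) -> (exists y, y * c2 = 1) ->
    (exists y, y * c3 = 1) -> (exists y, y * a = 1) ->
    (exists y, y * \det G = 1) ->
    \det G * c3 = a ^+ 2 * (c1 * c2) ->
  A c1 * A c2 =
    gauss T (orthosum (m := 2) (fun x y => trace4 (bil G x y))) * A c3.
Proof.
move=> R4 he Rloc; have [zeta zetaE] := Z4_morph R4.
have tD := trace4D zetaE he.
have [tF tN] := trace4_mod2 zetaE he Rloc.
have [R' eR] := basis4_finite he; subst R.
exact: (gauss_relation_finite T R4 tD Rloc tF tN).
Qed.

(** An orientation generates the exterior power, so the wedge of any basis is a multiple
of it; a and b are these multiples. *)
Lemma wedge_gram (R : comNzRingType) (V : lmodType R) (omega : {biscalar V})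
    n (L M : olag omega n) (l : 'I_n -> submod L) (m : 'I_n -> submod M) a b :
    wedge [ffun i => l i] = a *: orient L -> wedge [ffun i => m i] = b *: orient M ->
  \det (gram omega l m) = a * b * omega_wedge omega (orient L) (orient M).
Proof.
move=> eL eM; rewrite -omega_wedgeZ -eL -eM omega_wedgeE.
by congr (\det _); apply/matrixP => i j; rewrite !mxE !ffunE.
Qed.

(** The determinants of the pairing matrices are units, hence so are the factors that
compare the bases with the orientations and the pairings of the orientations. In
[det_maslov] the factors of L and N cancel and that of M enters squared. *)
Lemma oriented_cocycle (T : realType) (n : nat) (R : comNzRingType)
    (R4 : 4%:R = 0 :> R)
    (Rloc : forall x : R, x \in @twice R \/ (exists y, y * x = 1))
    (n0 : (0 < n)%N) (V : lmodType R) (omega : {biscalar V})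
    (homega : symplectic omega) (N M L : olag omega n)
    (hNM : general_position N M) (hML : general_position M L)
    (hNL : general_position N L) :
  Acoef T N M * Acoef T M L =
  gauss T (orthosum (m := 2) (fun m1 m2 : submod M =>
    - trace4 (omega_along omega N L m1 m2))) * Acoef T N L.
Proof.
have [e be] := lag_free N; have [m bm] := lag_free M; have [l bl] := lag_free L.
have [aN eN] := orientP (wedge [ffun i => e i]).
have [aM eM] := orientP (wedge [ffun i => m i]).
have [aL eL] := orientP (wedge [ffun i => l i]).
have wML := wedge_gram eL eM; have wNM := wedge_gram eM eN.
have wNL := wedge_gram eL eN.
have [lN lM lL] : [/\ lagrangian omega N, lagrangian omega M & lagrangian omega L].
  by split; apply: lagP.
have [yML uML] := gram_unit homega lM lL hML bm bl.
have [yNM uNM] := gram_unit homega lN lM hNM be bm.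
have [yNL uNL] := gram_unit homega lN lL hNL be bl.
pose G := maslov_mx omega N L m.
have Gs : G^T = G by apply: tr_maslov.
have dG : \det G * \det (gram omega l e) =
    \det (gram omega l m) * \det (gram omega m e) by apply: det_maslov.
have combB : zmod_morphism (comb m).
  by move=> x y; rewrite addrC -scaleN1r combP scaleN1r addrC.
(* Without a finite Z/4-basis the trace is its default value 0. *)
have [[d [b hb]]|nb] := pselect (exists d (b : 'I_d -> R), is_basis4 b); last first.
  have t0 := trace4_no_basis nb.
  rewrite /Acoef mulrC; congr (_ * _); last first.
    congr (gauss T (orthosum _)).
    by apply/funext => x; apply/funext => y; rewrite !t0.
  rewrite (gauss_orthosum_iso T combB (comb_bij bm)).
    congr (gauss T (orthosum _)).
    by apply/funext => x; apply/funext => y; rewrite !t0 oppr0.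
  by move=> v u; apply: eq_bigr => i _; rewrite !t0.
have [zeta zetaE] := Z4_morph R4.
have GE : (fun x y : 'rV[R]_n =>
      - trace4 (omega_along omega N L (comb m x) (comb m y))) =
    (fun x y => trace4 (bil G x y)).
  apply/funext => x; apply/funext => y.
  by rewrite -(trace4N zetaE hb) maslov_mxE.
rewrite (gauss_orthosum_iso T combB (comb_bij bm)) GE; last exact: orthosum_form_mod2.
have [u uNL'] : exists u, u * (aL * aN) = 1.
  exists (yNL * omega_wedge omega (orient L) (orient N)).
  by rewrite -uNL wNL; ring.
apply: (gauss_relation T (a := aM) R4 hb Rloc n0 Gs).
- by exists (yNM * (aM * aN)); rewrite -uNM wNM; ring.
- by exists (yML * (aL * aM)); rewrite -uML wML; ring.
- by exists (yNL * (aL * aN)); rewrite -uNL wNL; ring.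
- exists (yNM * aN * omega_wedge omega (orient M) (orient N)).
  by rewrite -uNM wNM; ring.
- exists (yML * yNM * \det (gram omega l e)).
  transitivity (yML * yNM * (\det G * \det (gram omega l e))); first by ring.
  by rewrite dG mulrACA uML uNM mulr1.
- rewrite -[LHS]mul1r -[RHS]mul1r -uNL'.
  transitivity (u * (\det G * \det (gram omega l e))); first by rewrite wNL; ring.
  by rewrite dG wML wNM; ring.
Qed.

Lemma RK_char4 (K : fieldExtType Q2) : 4%:R = 0 :> RK K.
Proof.
pose p : {rmorphism OK K -> RK K} := \pi_(RK K)%qT.
rewrite -(rmorph_nat p); apply/eqP.
rewrite -(rmorph0 p) -Quotient.idealrBE subr0.
by apply/asboolP; exists 1; rewrite mulr1 -natrX.
Qed.

(** Unramified means that the non-units of O_K are the multiples of 2. *)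
Lemma RK_local (K : fieldExtType Q2) : unramified K ->
  forall x : RK K, x \in @twice (RK K) \/ (exists y, y * x = 1).
Proof.
move=> hK x; pose p : {rmorphism OK K -> RK K} := \pi_(RK K)%qT.
have -> : x = p (repr x) by exact/esym/reprK.
have [/asboolP[y ->]|nr] := boolP (repr x \in @mK K).
  by left; apply/twiceP; exists (p y); rewrite rmorphM rmorph_nat mulr_natl.
right; have [y yr] : exists y, y * repr x = 1.
  by apply: contrapT => /hK; rewrite (negPf nr).
by exists (p y); rewrite -rmorphM yr rmorph1.
Qed.

Theorem theorem6p2 (T : realType) (d n : nat) (K : fieldExtType Q2)
    (hd : \dim {:K} = d) (hK : unramified K)
    (hn : (0 < n)%N)
    (V : lmodType (RK K)) (omega : {biscalar V})
    (hV : free_of_rank (2 * n) V) (homega : symplectic omega)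
    (N M L : olag omega n)
    (hNM : general_position N M) (hML : general_position M L)
    (hNL : general_position N L) :
  Acoef T N M * Acoef T M L =
  gauss T (orthosum (m := 2) (fun m1 m2 : submod M =>
    - trace4 (omega_along omega N L m1 m2))) * Acoef T N L.
Proof.
exact: (oriented_cocycle T (@RK_char4 K) (RK_local hK) hn homega hNM hML hNL).
Qed.
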